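(* Let $a,b,c$ be positive numbers with $a<b<c$, $b-a<c_0<a$ (where $c_0=c-\lfloor c/b\rfloor b$), $\lfloor c/b\rfloor\ge2$ and $a/b\notin\mathbb Q$. Assume $\mathcal S_{a,b,c}\ne\emptyset$. Then there is an integer $D$ with $0\le D\le\lfloor a/(b-a)\rfloor-1$ such that (1) $(\tilde R_{a,b,c})^n(c_0+a-b)+a\mathbb Z=(R_{a,b,c})^{D-n}(c-c_0)+a\mathbb Z$ for all $0\le n\le D$; (2) the sets $(R_{a,b,c})^n(c-c_0)+[0,b-a]+a\mathbb Z$, $0\le n\le D$, are pairwise disjoint; (3) $\mathbb R\setminus\mathcal S_{a,b,c}=\bigcup_{n=0}^D\big((R_{a,b,c})^n(c-c_0)+[0,b-a)+a\mathbb Z\big)=\bigcup_{n=0}^D(R_{a,b,c})^n([c-c_0,c-c_0+b-a)+a\mathbb Z)=\bigcup_{n=0}^D(\tilde R_{a,b,c})^n([c_0+a-b,c_0)+a\mathbb Z)=\bigcup_{n=0}^D\big((\tilde R_{a,b,c})^n(c_0+a-b)+[0,b-a)+a\mathbb Z\big)$.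
   Context: For $a,b,c>0$ and $t\in\mathbb R$, $\mathbf M_{a,b,c}(t)=(\chi_{[0,c)}(t-\mu+\lambda))_{\mu\in a\mathbb Z,\lambda\in b\mathbb Z}$ is the infinite matrix with rows indexed by $a\mathbb Z$ and columns by $b\mathbb Z$, acting by $(\mathbf M_{a,b,c}(t)\mathbf x)(\mu)=\sum_{\lambda\in b\mathbb Z}\chi_{[0,c)}(t-\mu+\lambda)\mathbf x(\lambda)$. $\mathcal B_b^0$ is the set of vectors $(\mathbf x(\lambda))_{\lambda\in b\mathbb Z}$ with entries in $\{0,1\}$ and $\mathbf x(0)=1$. $\mathbf 1$ denotes the vector indexed by $a\mathbb Z$ with all entries $1$. $\mathcal S_{a,b,c}=\{t:\mathbf M_{a,b,c}(t)\mathbf x=\mathbf 1\text{ for some }\mathbf x\in\mathcal B_b^0\}$. With $c_0=c-\lfloor c/b\rfloor b$ and $b-a<c_0<a$: $R_{a,b,c}(t)=t+\lfloor c/b\rfloor b+b$ if $t\in[0,c_0+a-b)+a\mathbb Z$, $R_{a,b,c}(t)=t$ if $t\in[c_0+a-b,c_0)+a\mathbb Z$, $R_{a,b,c}(t)=t+\lfloor c/b\rfloor b$ if $t\in[c_0,a)+a\mathbb Z$; $\tilde R_{a,b,c}(t)=t-\lfloor c/b\rfloor b$ if $t\in[c-a,c-c_0)+a\mathbb Z$, $\tilde R_{a,b,c}(t)=t$ if $t\in[c-c_0,c-c_0+b-a)+a\mathbb Z$, $\tilde R_{a,b,c}(t)=t-\lfloor c/b\rfloor b-b$ if $t\in[c-c_0+b-a,c)+a\mathbb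 Z$. $T^n$ is the $n$-fold iterate ($T^0=$ identity), $A+a\mathbb Z=\{x+ak:x\in A,k\in\mathbb Z\}$, and $x+A=\{x+y:y\in A\}$. *)

(* Defs.v *)
From Stdlib Require Import Reals Lra Lia ZArith Classical ClassicalEpsilon.
Open Scope R_scope.

Definition flr (x : R) : Z := Int_part x.

Definition chi (c x : R) : R :=
  if excluded_middle_informative (0 <= x < c) then 1 else 0.

Definition plusaZ (a : R) (A : R -> Prop) : R -> Prop :=
  fun t => exists (x : R) (k : Z), A x /\ t = x + a * IZR k.

Definition Ico (u v : R) : R -> Prop := fun x => u <= x < v.

(* Row mu = a*m of M_{a,b,c}(t) x : the (finitely supported) series
   sum_{lambda in bZ} chi_[0,c)(t - mu + lambda) x(lambda),
   taken as the limit of symmetric partial sums over k = -N..N (lambda = b k). *)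
Definition row_sum (a b c t : R) (x : Z -> R) (m : Z) (N : nat) : R :=
  sum_f_R0 (fun n => let k := (Z.of_nat n - Z.of_nat N)%Z in
                     chi c (t - IZR m * a + IZR k * b) * x k) (2 * N).

(* x in B_b^0 (indexed by k with lambda = b k) *)
Definition in_B0 (x : Z -> R) : Prop :=
  (forall k, x k = 0 \/ x k = 1) /\ x 0%Z = 1.

Definition S_abc (a b c t : R) : Prop :=
  exists x : Z -> R, in_B0 x /\
    forall m : Z, Un_cv (row_sum a b c t x m) 1.

Definition c0 (b c : R) : R := c - IZR (flr (c / b)) * b.

Definition R_abc (a b c t : R) : R :=
  let N := IZR (flr (c / b)) in
  if excluded_middle_informative (plusaZ a (Ico 0 (c0 b c + a - b)) t)
  then t + N * b + b
  else if excluded_middle_informative (plusaZ a (Ico (c0 b c + a - b) (c0 b c)) t)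
  then t
  else t + N * b.  (* case t in [c0,a) + aZ *)

Definition Rt_abc (a b c t : R) : R :=
  let N := IZR (flr (c / b)) in
  if excluded_middle_informative (plusaZ a (Ico (c - a) (c - c0 b c)) t)
  then t - N * b
  else if excluded_middle_informative (plusaZ a (Ico (c - c0 b c) (c - c0 b c + b - a)) t)
  then t
  else t - N * b - b.  (* case t in [c - c0 + b - a, c) + aZ *)

Definition Riter (n : nat) (f : R -> R) (x : R) : R := Nat.iter n f x.

(* Main.v *)
Require Import Defs.
From Stdlib Require Import Reals Lra Lia ZArith List ClassicalEpsilon.
Open Scope R_scope.

(** Reading a binary solution as a subset of [t + bZ] meeting every window
    [[am, am + c)] exactly once, [R_abc] and [Rt_abc] send a point to its successor
    and predecessor, so [S_abc] is the set of points whose two-sided orbit avoids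
    the holes [[c0+a-b, c0) + aZ] and [[c-c0, c-c0+b-a) + aZ].

    Modulo [a], [R_abc] preserves the cyclic order off the first hole; its monotone
    lift closes that hole to a point and opens the second hole at the points of [aZ].
    Follow the Dedekind cut of [S_abc] at [0] under the lift.  Its gap changes length
    only by [b - a], upwards at the cut [0] and downwards at the cut through the
    hole.  As [a/b] is irrational, the successive cuts are distinct modulo [a], so
    their gaps are disjoint and only finitely many have length above a given bound.
    Hence the hole is reached exactly once, and the lengths are [0], then [b - a]
    for [D + 1] steps, then [0]: the gap opened at [0] is carried rigidly onto the
    hole, and these [D + 1] gaps are the complement of [S_abc]. *)

(** * Floors and finite combinatorics *)

Lemma flr_spec (x : R) : IZR (flr x) <= x < IZR (flr x) + 1.
Proof. unfold flr; destruct (base_Int_part x); lra. Qed.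

Definition fl (a x : R) : Z := flr (x / a).

Lemma fl_spec (a x : R) : 0 < a -> a * IZR (fl a x) <= x < a * IZR (fl a x) + a.
Proof.
  intros Ha; unfold fl; pose proof (flr_spec (x / a)) as [H1 H2].
  apply (Rmult_le_compat_l a) in H1; [|lra].
  apply (Rmult_lt_compat_l a) in H2; [|lra].
  replace (a * (x / a)) with x in * by (field; lra); lra.
Qed.

Lemma IZR_mul_lt (a : R) (j k : Z) :
  0 < a -> a * IZR j < a * IZR k + a -> (j <= k)%Z.
Proof.
  intros Ha H; apply Z.lt_succ_r, lt_IZR; rewrite succ_IZR.
  apply (Rmult_lt_reg_l a); lra.
Qed.

Lemma fl_le (a x : R) (k : Z) : 0 < a -> x < a * IZR k + a -> (fl a x <= k)%Z.
Proof. intros Ha H; pose proof (fl_spec a x Ha); apply (IZR_mul_lt a); lra. Qed.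

Lemma fl_ge (a x : R) (k : Z) : 0 < a -> a * IZR k <= x -> (k <= fl a x)%Z.
Proof. intros Ha H; pose proof (fl_spec a x Ha); apply (IZR_mul_lt a); lra. Qed.

Lemma fl_unique (a x : R) (k : Z) :
  0 < a -> a * IZR k <= x < a * IZR k + a -> fl a x = k.
Proof.
  intros Ha [H1 H2]; apply Z.le_antisymm; [apply fl_le | apply fl_ge]; assumption.
Qed.

Lemma fl_mono (a x y : R) : 0 < a -> x <= y -> (fl a x <= fl a y)%Z.
Proof. intros Ha H; pose proof (fl_spec a x Ha); apply fl_ge; lra. Qed.

Lemma fl_shift (a x : R) (k : Z) : 0 < a -> fl a (x + a * IZR k) = (fl a x + k)%Z.
Proof.
  intros Ha; pose proof (fl_spec a x Ha).
  apply fl_unique; [assumption|]; rewrite plus_IZR; lra.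
Qed.

Lemma choice {A B : Type} (R : A -> B -> Prop) :
  (forall x, exists y, R x y) -> exists f : A -> B, forall x, R x (f x).
Proof.
  intros H; exists (fun x => proj1_sig (constructive_indefinite_description _ (H x))).
  intros x; exact (proj2_sig (constructive_indefinite_description _ (H x))).
Qed.

(** Each improvement lowers the natural number [B - f x], so the search for a larger value ends. *)
Lemma Z_argmax {T : Type} (P : T -> Prop) (f : T -> Z) (B : Z) :
  (exists x, P x) -> (forall x, P x -> (f x <= B)%Z) ->
  exists x, P x /\ forall y, P y -> (f y <= f x)%Z.
Proof.
  intros [x0 Hx0] HB.
  remember (Z.to_nat (B - f x0)) as n eqn:En.
  revert x0 Hx0 En; induction n as [n IH] using lt_wf_ind; intros x0 Hx0 En.
  destruct (classic (exists y, P y /\ (f x0 < f y)%Z)) as [[y [Py Hy]]|Hno].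
  - apply (IH (Z.to_nat (B - f y))) with y; trivial.
    pose proof (HB y Py); lia.
  - exists x0; split; [assumption|]; intros y Py.
    destruct (Z_le_gt_dec (f y) (f x0)); [assumption|].
    exfalso; apply Hno; exists y; split; [assumption|lia].
Qed.

Lemma injection_bound (K M : nat) (q : nat -> nat) :
  (forall i, (i < K)%nat -> (q i < M)%nat) ->
  (forall i j, (i < K)%nat -> (j < K)%nat -> q i = q j -> i = j) -> (K <= M)%nat.
Proof.
  intros Hq Hinj.
  rewrite <- (length_seq K 0), <- (length_seq M 0), <- (length_map q (seq 0 K)).
  apply NoDup_incl_length.
  - apply NoDup_map_NoDup_ForallPairs; [|apply seq_NoDup].
    intros i j Hi Hj; apply in_seq in Hi, Hj; apply Hinj; lia.
  - intros y Hy; apply in_map_iff in Hy; destruct Hy as [i [<- Hi]].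
    apply in_seq in Hi; apply in_seq; specialize (Hq i); lia.
Qed.

(** The separation hypothesis makes the arcs [[u i, u i + d)] disjoint on the circle of length [a].
    Two arcs whose left ends share a cell of a grid of mesh [d] would overlap, and only
    [flr (a / d)] cells are available. *)
Lemma arc_packing (a d : R) (K : nat) (u : nat -> R) :
  0 < d <= a ->
  (forall i j k, (i < K)%nat -> (j < K)%nat -> i <> j ->
     u i + d <= u j + a * IZR k \/ u j + a * IZR k + d <= u i) ->
  (Z.of_nat K <= flr (a / d))%Z.
Proof.
  intros Hd Hsep.
  assert (Ha : 0 < a) by lra.
  assert (Hdpos : 0 < d) by lra.
  (* Positions are measured from [u 0]: the next copy of arc [0], at distance [a], then keeps every
     other arc from wrapping around, whence [w i <= a - d]. *)
  pose (w i := u i - u 0%nat - a * IZR (fl a (u i - u 0%nat))).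
  assert (Hw : forall i, (i < K)%nat -> 0 <= w i <= a - d).
  { intros i Hi; unfold w.
    pose proof (fl_spec a (u i - u 0%nat) Ha) as Hs.
    split; [lra|].
    destruct (Nat.eq_dec i 0) as [->|Hi0].
    - rewrite (fl_unique a (u 0%nat - u 0%nat) 0); lra.
    - destruct (Hsep i 0%nat (fl a (u i - u 0%nat) + 1)%Z Hi ltac:(lia) Hi0) as [H|H];
        rewrite plus_IZR in H; lra. }
  assert (Hq : forall i, (i < K)%nat -> (0 <= fl d (w i) <= flr (a / d) - 1)%Z).
  { intros i Hi; specialize (Hw i Hi); split.
    - apply fl_ge; lra.
    - enough (fl d (w i) + 1 <= flr (a / d))%Z by lia.
      pose proof (fl_spec d (w i) Hdpos).
      apply fl_ge; [lra|]; rewrite plus_IZR; lra. }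
  enough (K <= Z.to_nat (flr (a / d)))%nat.
  { pose proof (fl_ge d a 0 Hdpos ltac:(lra)) as H0; unfold fl in H0; lia. }
  apply (injection_bound K _ (fun i => Z.to_nat (fl d (w i)))).
  - intros i Hi; specialize (Hq i Hi); lia.
  - intros i j Hi Hj E.
    assert (E' : fl d (w i) = fl d (w j)).
    { pose proof (Hq i Hi); pose proof (Hq j Hj); lia. }
    pose proof (fl_spec d (w i) Hdpos) as Si; pose proof (fl_spec d (w j) Hdpos) as Sj.
    rewrite E' in Si.
    destruct (Nat.eq_dec i j) as [|Hij]; [assumption|exfalso].
    destruct (Hsep i j (fl a (u i - u 0%nat) - fl a (u j - u 0%nat))%Z Hi Hj Hij) as [H|H];
      rewrite minus_IZR in H; unfold w in Si, Sj; lra.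
Qed.

Lemma arc_packing_finite (a d : R) (u : nat -> R) :
  0 < a -> 0 < d ->
  (forall i j k, i <> j -> u i + d <= u j + a * IZR k \/ u j + a * IZR k + d <= u i) ->
  False.
Proof.
  intros Ha Hd Hsep.
  (* Shorter arcs stay disjoint, and [e <= a] is what [arc_packing] asks for. *)
  pose (e := Rmin d a).
  assert (He : 0 < e <= a).
  { unfold e; split; [apply Rmin_glb_lt; lra | apply Rmin_r]. }
  assert (Hed : e <= d) by apply Rmin_l.
  pose proof (arc_packing a e (S (Z.to_nat (flr (a / e)))) u He) as H.
  enough (Z.of_nat (S (Z.to_nat (flr (a / e)))) <= flr (a / e))%Z by lia.
  apply H; intros i j k _ _ Hij; destruct (Hsep i j k Hij); lra.
Qed.

(** * Dedekind cuts of a periodic set *)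

Record is_cut (Y L U : R -> Prop) : Prop := {
  cut_L : forall x, L x -> Y x;
  cut_U : forall y, U y -> Y y;
  cut_cover : forall x, Y x -> L x \/ U x;
  cut_lt : forall x y, L x -> U y -> x < y;
  cut_L_ex : exists x, L x;
  cut_U_ex : exists y, U y
}.

(** The cut is made by a point of [o + aZ]. That point itself counts upward, in agreement with the
    right-continuity of the floor function. *)
Definition cut_at (a o : R) (L U : R -> Prop) : Prop :=
  exists k : Z, (forall x, L x -> x < o + a * IZR k) /\ (forall y, U y -> o + a * IZR k <= y).

Definition is_glb (E : R -> Prop) (m : R) : Prop :=
  (forall x, E x -> m <= x) /\ (forall w, (forall x, E x -> w <= x) -> w <= m).

Definition image (F : R -> R) (E : R -> Prop) : R -> Prop :=
  fun y => exists x, E x /\ y = F x.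

Lemma glb_exists (E : R -> Prop) (w : R) :
  (exists x, E x) -> (forall x, E x -> w <= x) -> exists m, is_glb E m.
Proof.
  intros [x0 Hx0] Hw.
  destruct (completeness (fun x => E (- x))) as [m [Hm1 Hm2]].
  - exists (- w); intros x Hx; specialize (Hw _ Hx); lra.
  - exists (- x0); rewrite Ropp_involutive; assumption.
  - exists (- m); split.
    + intros x Hx; enough (- x <= m) by lra.
      apply Hm1; rewrite Ropp_involutive; assumption.
    + intros v Hv; enough (m <= - v) by lra.
      apply Hm2; intros x Hx; specialize (Hv _ Hx); lra.
Qed.

Lemma cut_lub_glb (Y L U : R -> Prop) :
  is_cut Y L U -> exists u v, is_lub L u /\ is_glb U v /\ u <= v.
Proof.
  intros HC; destruct (cut_L_ex _ _ _ HC) as [x Hx], (cut_U_ex _ _ _ HC) as [y Hy].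
  destruct (completeness L) as [u Hu].
  - exists y; intros z Hz; left; exact (cut_lt _ _ _ HC z y Hz Hy).
  - exists x; assumption.
  - destruct (glb_exists U x) as [v Hv].
    + exists y; assumption.
    + intros z Hz; left; exact (cut_lt _ _ _ HC x z Hx Hz).
    + exists u, v; repeat split; try apply Hu; try apply Hv.
      intros z Hz; apply Hv; intros z' Hz'; left; exact (cut_lt _ _ _ HC z z' Hz Hz').
Qed.

(** A supremum only depends on the part of [L] beyond [x0], where [F] is a translation; monotonicity
    keeps the images of the other points below. *)
Lemma lub_translate (F : R -> R) (L : R -> Prop) (u d x0 : R) :
  is_lub L u -> L x0 -> (forall x, L x -> x0 <= x -> F x = x + d) ->
  (forall x y, L x -> L y -> x <= y -> F x <= F y) -> is_lub (image F L) (u + d).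
Proof.
  intros [Hu1 Hu2] Hx0 HF Hmono; split.
  - intros y [x [Hx ->]]; destruct (Rle_lt_dec x0 x) as [H|H].
    + rewrite HF by assumption; specialize (Hu1 x Hx); lra.
    + apply Rle_trans with (F x0); [apply Hmono; trivial; lra|].
      rewrite HF by (trivial; lra); specialize (Hu1 x0 Hx0); lra.
  - intros w Hw; enough (u <= w - d) by lra.
    apply Hu2; intros x Hx; destruct (Rle_lt_dec x0 x) as [H|H].
    + enough (F x <= w) by (rewrite HF in *; trivial; lra).
      apply Hw; exists x; split; trivial.
    + enough (F x0 <= w) by (rewrite HF in *; trivial; lra).
      apply Hw; exists x0; split; trivial.
Qed.

Lemma glb_translate (F : R -> R) (U : R -> Prop) (v d y0 : R) :
  is_glb U v -> U y0 -> (forall y, U y -> y <= y0 -> F y = y + d) ->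
  (forall x y, U x -> U y -> x <= y -> F x <= F y) -> is_glb (image F U) (v + d).
Proof.
  intros [Hv1 Hv2] Hy0 HF Hmono; split.
  - intros y [x [Hx ->]]; destruct (Rle_lt_dec x y0) as [H|H].
    + rewrite HF by assumption; specialize (Hv1 x Hx); lra.
    + apply Rle_trans with (F y0); [|apply Hmono; trivial; lra].
      rewrite HF by (trivial; lra); specialize (Hv1 y0 Hy0); lra.
  - intros w Hw; enough (w - d <= v) by lra.
    apply Hv2; intros x Hx; destruct (Rle_lt_dec x y0) as [H|H].
    + enough (w <= F x) by (rewrite HF in *; trivial; lra).
      apply Hw; exists x; split; trivial.
    + enough (w <= F y0) by (rewrite HF in *; trivial; lra).
      apply Hw; exists y0; split; trivial.
Qed.

Lemma glb_unique (E : R -> Prop) (m m' : R) : is_glb E m -> is_glb E m' -> m = m'.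
Proof. intros [H1 H2] [H1' H2']; apply Rle_antisym; auto. Qed.

Lemma cut_image (Y L U : R -> Prop) (F : R -> R) :
  (forall x, Y x -> Y (F x)) -> (forall y, Y y -> exists x, Y x /\ y = F x) ->
  (forall x y, Y x -> Y y -> x < y -> F x < F y) ->
  is_cut Y L U -> is_cut Y (image F L) (image F U).
Proof.
  intros HF Hsur Hmono [HL HU Hcov Hlt [x0 Hx0] [y0 Hy0]]; split.
  - intros x [x' [Hx ->]]; auto.
  - intros x [x' [Hx ->]]; auto.
  - intros y Hy; destruct (Hsur y Hy) as [x [Hx ->]].
    destruct (Hcov x Hx); [left | right]; exists x; auto.
  - intros x y [x' [Hx ->]] [y' [Hy ->]]; auto.
  - exists (F x0), x0; auto.
  - exists (F y0), y0; auto.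
Qed.

(* Near the cut, the floor function with jumps at [o + aZ] is constant on each
   side, and the two values differ exactly when the cut sits at a jump. *)
Lemma cut_floor_germ (a o : R) (Y L U : R -> Prop) :
  0 < a -> (forall x k, Y x -> Y (x + a * IZR k)) -> is_cut Y L U ->
  exists x0 y0 kL kU, L x0 /\ U y0 /\
    (forall x, L x -> x0 <= x -> fl a (x - o) = kL) /\
    (forall y, U y -> y <= y0 -> fl a (y - o) = kU) /\
    ((kU = kL /\ ~ cut_at a o L U) \/ (kU = kL + 1 /\ cut_at a o L U)%Z).
Proof.
  intros Ha Hper HC.
  destruct (cut_L_ex _ _ _ HC) as [x1 Hx1], (cut_U_ex _ _ _ HC) as [y1 Hy1].
  assert (Hle : forall x y, L x -> U y -> (fl a (x - o) <= fl a (y - o))%Z).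
  { intros x y Hx Hy; apply fl_mono; [assumption|].
    pose proof (cut_lt _ _ _ HC x y Hx Hy); lra. }
  destruct (Z_argmax L (fun x => fl a (x - o)) (fl a (y1 - o))) as [x0 [Hx0 Mx]];
    [eauto | auto |].
  destruct (Z_argmax U (fun y => - fl a (y - o))%Z (- fl a (x1 - o))%Z) as [y0 [Hy0 My]].
  { eauto. }
  { intros y Hy; specialize (Hle x1 y Hx1 Hy); lia. }
  exists x0, y0, (fl a (x0 - o)), (fl a (y0 - o)).
  split; [assumption|]; split; [assumption|]; split.
  { intros x Hx Hxx; apply Z.le_antisymm; [apply Mx; assumption|].
    apply fl_mono; lra. }
  split.
  { intros y Hy Hyy; apply Z.le_antisymm; [apply fl_mono; lra|].
    specialize (My y Hy); lia. }
  (* The translate of [x0] by one period has floor one above the maximum over [L]. It therefore lies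
     in [U], where it bounds the minimum. *)
  assert (Hjump : (fl a (y0 - o) <= fl a (x0 - o) + 1)%Z).
  { assert (Y (x0 + a * IZR 1)) as HY by (apply Hper, (cut_L _ _ _ HC); assumption).
    assert (E : fl a (x0 + a * IZR 1 - o) = (fl a (x0 - o) + 1)%Z).
    { rewrite <- fl_shift by assumption; f_equal; ring. }
    destruct (cut_cover _ _ _ HC _ HY) as [H|H].
    - apply Mx in H; lia.
    - apply My in H; lia. }
  destruct (Z.eq_dec (fl a (y0 - o)) (fl a (x0 - o))) as [E|E].
  - left; split; [assumption|]; intros [k [HkL HkU]].
    specialize (HkL x0 Hx0); specialize (HkU y0 Hy0).
    assert (k <= fl a (y0 - o))%Z by (apply fl_ge; lra).
    assert (fl a (x0 - o) <= k - 1)%Z by (apply fl_le; [lra|]; rewrite minus_IZR; lra).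
    lia.
  - right; specialize (Hle x0 y0 Hx0 Hy0); split; [lia|].
    exists (fl a (y0 - o)); split.
    + intros x Hx; specialize (Mx x Hx); pose proof (fl_spec a (x - o) Ha).
      assert (IZR (fl a (x - o)) <= IZR (fl a (y0 - o) - 1)) as Hk by (apply IZR_le; lia).
      rewrite minus_IZR in Hk; apply (Rmult_le_compat_l a) in Hk; lra.
    + intros y Hy; specialize (My y Hy); pose proof (fl_spec a (y - o) Ha).
      assert (IZR (fl a (y0 - o)) <= IZR (fl a (y - o))) as Hk by (apply IZR_le; lia).
      apply (Rmult_le_compat_l a) in Hk; lra.
Qed.

(** * Orbits of gaps *)

Section Gaps.

(** The intended values are [e0 = c0 b c], [N = flr (c / b)] and [Y = S_abc a b c]. Irrationality is
    stated with denominators cleared. *)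
Context (a b e0 : R) (N : Z) (Y : R -> Prop).
Hypothesis a_pos : 0 < a.
Hypothesis a_lt_b : a < b.
Hypothesis e0_gt : b - a < e0.
Hypothesis e0_lt : e0 < a.
Hypothesis N_ge2 : (2 <= N)%Z.
Hypothesis ab_irrational : forall p q : Z, a * IZR p = b * IZR q -> q = 0%Z.

Definition hole : R -> Prop := plusaZ a (Ico (e0 + a - b) e0).

(** This is the indicator of [[0, e0) + aZ]. Written with two floors, it has its upward jumps at
    [aZ] and its downward jumps at [e0 + aZ] accounted for separately, which is how [gap_step]
    follows them across a cut. *)
Definition iota (x : R) : Z := (fl a x - fl a (x - e0))%Z.

(* The monotone lift of [R_abc], from which it differs by multiples of [a]: it
   closes each hole to a point and opens a gap of length [b - a] at each point
   of [aZ]. *)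
Definition lift (x : R) : R := x + IZR N * b + (b - a) * IZR (iota x).

Lemma iota_cases (x : R) :
  (iota x = 1%Z /\ exists k : Z, a * IZR k <= x < a * IZR k + e0) \/
  (iota x = 0%Z /\ exists k : Z, a * IZR k + e0 <= x < a * IZR k + a).
Proof.
  unfold iota; pose proof (fl_spec a x a_pos).
  destruct (Rlt_le_dec x (a * IZR (fl a x) + e0)).
  - left; rewrite (fl_unique a (x - e0) (fl a x - 1));
      [|assumption|rewrite minus_IZR; lra].
    split; [lia|]; exists (fl a x); lra.
  - right; rewrite (fl_unique a (x - e0) (fl a x)); [|assumption|lra].
    split; [lia|]; exists (fl a x); lra.
Qed.

Lemma iota_bounds (x : R) : (0 <= iota x <= 1)%Z.
Proof. destruct (iota_cases x) as [[-> _]|[-> _]]; lia. Qed.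

Lemma iota_shift (x : R) (k : Z) : iota (x + a * IZR k) = iota x.
Proof.
  unfold iota; replace (x + a * IZR k - e0) with (x - e0 + a * IZR k) by ring.
  rewrite !fl_shift by assumption; lia.
Qed.

Lemma hole_intro (x : R) (k : Z) :
  e0 + a - b + a * IZR k <= x < e0 + a * IZR k -> hole x.
Proof. intros H; exists (x - a * IZR k), k; unfold Ico; split; [lra|ring]. Qed.

(** The increment of [lift] decreases only when [iota x = 1] and [iota y = 0]. A whole hole then
    lies between [x] and [y], and its length [b - a] is exactly the loss. *)
Lemma lift_lt (x y : R) : ~ hole x -> ~ hole y -> x < y -> lift x < lift y.
Proof.
  intros Hx Hy Hxy; unfold lift.
  destruct (iota_cases x) as [[-> [k Hk]]|[-> [k Hk]]],
    (iota_cases y) as [[-> [j Hj]]|[-> [j Hj]]]; try lra.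
  destruct (Rlt_le_dec x (a * IZR k + e0 + a - b)) as [Hl|Hl].
  - assert (k <= j)%Z as Hkj%IZR_le by (apply (IZR_mul_lt a); lra).
    apply (Rmult_le_compat_l a) in Hkj; lra.
  - exfalso; apply Hx, (hole_intro x k); lra.
Qed.

Hypothesis Y_shift : forall x k, Y x -> Y (x + a * IZR k).
Hypothesis Y_hole : forall x, Y x -> ~ hole x.
Hypothesis Y_lift : forall x, Y x -> Y (lift x).
Hypothesis Y_lift_onto : forall y, Y y -> exists x, Y x /\ y = lift x.
Hypothesis Y_ex : exists x, Y x.

Lemma Y_lift_lt (x y : R) : Y x -> Y y -> x < y -> lift x < lift y.
Proof. intros Hx Hy; apply lift_lt; apply Y_hole; assumption. Qed.

Lemma Y_lift_le (x y : R) : Y x -> Y y -> x <= y -> lift x <= lift y.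
Proof.
  intros Hx Hy [H| ->]; [left; apply Y_lift_lt; assumption | right; reflexivity].
Qed.

(** Both floors in [iota] are constant on each side near the cut, so [lift] translates the two ends
    [u] and [v] of the gap. The translations differ by the jump [jz] at [aZ] minus the jump [jh] at
    [e0 + aZ]. Without a jump, monotone floors that agree on both sides are constant on the whole
    gap. *)
Lemma gap_step (L U : R -> Prop) (u v : R) :
  is_cut Y L U -> is_lub L u -> is_glb U v ->
  exists eL eU jz jh : Z, (0 <= eL <= 1)%Z /\ (0 <= eU <= 1)%Z /\
    is_lub (image lift L) (u + (IZR N * b + (b - a) * IZR eL)) /\
    is_glb (image lift U) (v + (IZR N * b + (b - a) * IZR eU)) /\
    (eU - eL = jz - jh)%Z /\
    ((jz = 0%Z /\ ~ cut_at a 0 L U) \/ (jz = 1%Z /\ cut_at a 0 L U)) /\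
    ((jh = 0%Z /\ ~ cut_at a e0 L U) \/ (jh = 1%Z /\ cut_at a e0 L U)) /\
    (jz = 0%Z -> jh = 0%Z -> forall s, u <= s <= v -> iota s = eL /\ ~ hole s).
Proof.
  intros HC Hu Hv.
  destruct (cut_floor_germ a 0 Y L U a_pos Y_shift HC)
    as [x1 [y1 [kL [kU [Hx1 [Hy1 [GL1 [GU1 J1]]]]]]]].
  destruct (cut_floor_germ a e0 Y L U a_pos Y_shift HC)
    as [x2 [y2 [lL [lU [Hx2 [Hy2 [GL2 [GU2 J2]]]]]]]].
  assert (exists x0, L x0 /\ x1 <= x0 /\ x2 <= x0) as [x0 [Hx0 [Hx01 Hx02]]].
  { destruct (Rle_lt_dec x1 x2); [exists x2 | exists x1]; repeat split; trivial; lra. }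
  assert (exists y0, U y0 /\ y0 <= y1 /\ y0 <= y2) as [y0 [Hy0 [Hy01 Hy02]]].
  { destruct (Rle_lt_dec y1 y2); [exists y1 | exists y2]; repeat split; trivial; lra. }
  assert (IL : forall x, L x -> x0 <= x -> iota x = (kL - lL)%Z).
  { intros x Hx Hxx; unfold iota.
    rewrite <- (GL1 x), <- (GL2 x) by (trivial; lra); do 2 f_equal; lra. }
  assert (IU : forall y, U y -> y <= y0 -> iota y = (kU - lU)%Z).
  { intros y Hy Hyy; unfold iota.
    rewrite <- (GU1 y), <- (GU2 y) by (trivial; lra); do 2 f_equal; lra. }
  exists (kL - lL)%Z, (kU - lU)%Z, (kU - kL)%Z, (lU - lL)%Z.
  split; [rewrite <- (IL x0) by (trivial; lra); apply iota_bounds|].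
  split; [rewrite <- (IU y0) by (trivial; lra); apply iota_bounds|].
  split.
  { apply (lub_translate lift L u _ x0); trivial.
    - intros x Hx Hxx; unfold lift; rewrite IL by assumption; ring.
    - intros x y Hx Hy; apply Y_lift_le; apply (cut_L _ _ _ HC); assumption. }
  split.
  { apply (glb_translate lift U v _ y0); trivial.
    - intros x Hx Hxx; unfold lift; rewrite IU by assumption; ring.
    - intros x y Hx Hy; apply Y_lift_le; apply (cut_U _ _ _ HC); assumption. }
  split; [ring|].
  split; [destruct J1 as [[-> ?]|[-> ?]]; [left | right]; split; trivial; ring|].
  split; [destruct J2 as [[-> ?]|[-> ?]]; [left | right]; split; trivial; ring|].
  intros Ek El s Hs.
  assert (Hxs : x0 <= s) by (pose proof (proj1 Hu x0 Hx0); lra).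
  assert (Hsy : s <= y0) by (pose proof (proj1 Hv y0 Hy0); lra).
  assert (E : forall o k, fl a (x0 - o) = k -> fl a (y0 - o) = k -> fl a (s - o) = k).
  { intros o k E1 E2; apply Z.le_antisymm;
      [rewrite <- E2 | rewrite <- E1]; apply fl_mono; lra. }
  assert (Ez : fl a (s - 0) = kL).
  { apply E; [apply GL1; trivial; lra | rewrite GU1 by (trivial; lra); lia]. }
  assert (Eh : fl a (s - e0) = lL).
  { apply E; [apply GL2; trivial; lra | rewrite GU2 by (trivial; lra); lia]. }
  split.
  - unfold iota; rewrite <- Ez, <- Eh; do 2 f_equal; lra.
  (* A hole point [s] would put [y0] into the same hole: [y0] is to the right of [s], and the equal
     floors keep it below the right end. *)
  - intros [s' [k [Hs' ->]]]; unfold Ico in Hs'.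
    apply (Y_hole y0); [apply (cut_U _ _ _ HC); assumption|].
    apply (hole_intro y0 k).
    assert (E0 : fl a (y0 - e0) = (k - 1)%Z).
    { rewrite GU2 by (trivial; lra); replace lU with lL by lia; rewrite <- Eh.
      apply fl_unique; [assumption|]; rewrite minus_IZR; lra. }
    pose proof (fl_spec a (y0 - e0) a_pos) as Hsp; rewrite E0, minus_IZR in Hsp; lra.
Qed.

(** A point above one cut and below the translate of the other separates the gaps. If there is no
    such point in either order, the lower classes agree up to the translation, and so do their
    suprema. *)
Lemma cuts_compare (L U L' U' : R -> Prop) (u v u' v' : R) (k : Z) :
  is_cut Y L U -> is_lub L u -> is_glb U v ->
  is_cut Y L' U' -> is_lub L' u' -> is_glb U' v' ->
  v <= u' + a * IZR k \/ v' + a * IZR k <= u \/ u = u' + a * IZR k.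
Proof.
  intros HC [Hu Hu2] [Hv Hv2] HC' [Hu' Hu2'] [Hv' Hv2'].
  assert (Hneg : forall x, x + a * IZR (- k) = x - a * IZR k)
    by (intros x; rewrite opp_IZR; ring).
  destruct (classic (exists s, U s /\ L' (s - a * IZR k))) as [[s [H1 H2]]|H1].
  { left; apply Hv in H1; apply Hu' in H2; lra. }
  destruct (classic (exists s, L s /\ U' (s - a * IZR k))) as [[s [H2 H3]]|H2].
  { right; left; apply Hu in H2; apply Hv' in H3; lra. }
  right; right; apply Rle_antisym.
  - apply Hu2; intros x Hx.
    pose proof (Y_shift x (- k)%Z (cut_L _ _ _ HC x Hx)) as HY; rewrite Hneg in HY.
    destruct (cut_cover _ _ _ HC' _ HY) as [H|H].
    + apply Hu' in H; lra.
    + exfalso; apply H2; exists x; split; assumption.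
  - enough (u' <= u - a * IZR k) by lra.
    apply Hu2'; intros x Hx.
    pose proof (Y_shift x k (cut_L _ _ _ HC' x Hx)) as HY.
    destruct (cut_cover _ _ _ HC _ HY) as [H|H].
    + apply Hu in H; lra.
    + exfalso; apply H1; exists (x + a * IZR k); split; [assumption|].
      replace (x + a * IZR k - a * IZR k) with x by ring; assumption.
Qed.

(** A cut at a point of [o + aZ] is determined by that point, and [Y] is [a]-periodic, so two such
    cuts are translates of each other. This is what lets [aZ] and [e0 + aZ] be met only once
    each. *)
Lemma cut_at_lub_eq (o : R) (L U L' U' : R -> Prop) (u u' : R) :
  is_cut Y L U -> is_lub L u -> is_cut Y L' U' -> is_lub L' u' ->
  cut_at a o L U -> cut_at a o L' U' -> exists k : Z, u = u' + a * IZR k.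
Proof.
  (* One inequality, stated for arbitrary cuts so that it can be used in both directions. *)
  assert (Hle : forall L U L' U' u u' k k', is_cut Y L U -> is_lub L u ->
    is_cut Y L' U' -> is_lub L' u' -> (forall x, L x -> x < o + a * IZR k) ->
    (forall y, U' y -> o + a * IZR k' <= y) -> u <= u' + a * IZR (k - k')).
  { clear L U L' U' u u'; intros L U L' U' u u' k k' HC [_ Hu] HC' [Hu' _] HL HU'.
    apply Hu; intros x Hx.
    pose proof (Y_shift x (k' - k)%Z (cut_L _ _ _ HC x Hx)) as HY.
    specialize (HL x Hx); rewrite minus_IZR in *.
    destruct (cut_cover _ _ _ HC' _ HY) as [H|H].
    - apply Hu' in H; lra.
    - apply HU' in H; lra. }
  intros HC Hu HC' Hu' [k [HL HU]] [k' [HL' HU']].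
  exists (k - k')%Z; apply Rle_antisym.
  - apply (Hle L U L' U'); assumption.
  - pose proof (Hle L' U' L U u' u k' k HC' Hu' HC Hu HL' HU) as H.
    rewrite minus_IZR in *; lra.
Qed.

Let Lo (n : nat) : R -> Prop := Nat.iter n (image lift) (fun x => Y x /\ x < 0).
Let Up (n : nat) : R -> Prop := Nat.iter n (image lift) (fun x => Y x /\ 0 <= x).

Lemma Lo_Up_cut (n : nat) : is_cut Y (Lo n) (Up n).
Proof.
  induction n as [|n IH].
  - destruct Y_ex as [x Hx].
    pose proof (fl_spec a x a_pos) as Hf.
    simpl; split; try (intros; tauto).
    + intros y Hy; destruct (Rlt_le_dec y 0); tauto.
    + intros; lra.
    + exists (x + a * IZR (- fl a x - 1)); split; [auto|].
      rewrite minus_IZR, opp_IZR; lra.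
    + exists (x + a * IZR (- fl a x)); split; [auto|].
      rewrite opp_IZR; lra.
  - apply cut_image; [exact Y_lift | exact Y_lift_onto | exact Y_lift_lt | exact IH].
Qed.

(** [z j] is the lower end of cut [j + 1], and [e j] the value of [iota] along its gap. The index is
    shifted because the cut at the origin has no gap of its own and receives one at the first
    step. *)
Theorem gap_orbit :
  exists (D : nat) (z : nat -> R) (e : nat -> Z),
    (Z.of_nat D <= flr (a / (b - a)) - 1)%Z /\
    z 0%nat = IZR N * b /\
    (forall j, (j < D)%nat -> z (S j) = z j + IZR N * b + (b - a) * IZR (e j) /\
       (0 <= e j)%Z /\
       forall s, z j <= s < z j + (b - a) -> iota s = e j /\ ~ hole s) /\
    (exists k : Z, z D = e0 + a - b + a * IZR k) /\
    (forall i j k, (i <= D)%nat -> (j <= D)%nat -> i <> j ->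
       z i + (b - a) < z j + a * IZR k \/ z j + a * IZR k + (b - a) < z i).
Proof.
  assert (exists uv : nat -> R * R, forall n,
    is_lub (Lo n) (fst (uv n)) /\ is_glb (Up n) (snd (uv n)) /\ fst (uv n) <= snd (uv n))
    as [uv Huv].
  { apply choice with (R := fun n uv => is_lub (Lo n) (fst uv) /\
                         is_glb (Up n) (snd uv) /\ fst uv <= snd uv).
    intros n; destruct (cut_lub_glb _ _ _ (Lo_Up_cut n)) as [u [v H]].
    exists (u, v); exact H. }
  pose (u n := fst (uv n)); pose (v n := snd (uv n)).
  assert (Hu : forall n, is_lub (Lo n) (u n)) by (intros n; apply Huv).
  assert (Hv : forall n, is_glb (Up n) (v n)) by (intros n; apply Huv).
  assert (Huv' : forall n, u n <= v n) by (intros n; apply Huv).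
  clearbody u v; clear uv Huv.
  pose (Q n := cut_at a 0 (Lo n) (Up n)); pose (P n := cut_at a e0 (Lo n) (Up n)).
  assert (exists ee : nat -> Z * Z, forall n,
    let eL := fst (ee n) in let eU := snd (ee n) in
    exists jz jh : Z, (0 <= eL <= 1)%Z /\ (0 <= eU <= 1)%Z /\
    u (S n) = u n + (IZR N * b + (b - a) * IZR eL) /\
    v (S n) = v n + (IZR N * b + (b - a) * IZR eU) /\
    (eU - eL = jz - jh)%Z /\
    ((jz = 0%Z /\ ~ Q n) \/ (jz = 1%Z /\ Q n)) /\
    ((jh = 0%Z /\ ~ P n) \/ (jh = 1%Z /\ P n)) /\
    (jz = 0%Z -> jh = 0%Z -> forall s, u n <= s <= v n -> iota s = eL /\ ~ hole s))
    as [ee Hee].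
  { apply choice with (R := fun n (ee : Z * Z) =>
      let eL := fst ee in let eU := snd ee in
      exists jz jh : Z, (0 <= eL <= 1)%Z /\ (0 <= eU <= 1)%Z /\
      u (S n) = u n + (IZR N * b + (b - a) * IZR eL) /\
      v (S n) = v n + (IZR N * b + (b - a) * IZR eU) /\
      (eU - eL = jz - jh)%Z /\
      ((jz = 0%Z /\ ~ Q n) \/ (jz = 1%Z /\ Q n)) /\
      ((jh = 0%Z /\ ~ P n) \/ (jh = 1%Z /\ P n)) /\
      (jz = 0%Z -> jh = 0%Z -> forall s, u n <= s <= v n -> iota s = eL /\ ~ hole s)).
    intros n.
    destruct (gap_step (Lo n) (Up n) (u n) (v n) (Lo_Up_cut n) (Hu n) (Hv n))
      as [eL [eU [jz [jh [H1 [H2 [H3 [H4 H5]]]]]]]].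
    exists (eL, eU), jz, jh; simpl.
    split; [exact H1|]; split; [exact H2|].
    split; [exact (is_lub_u _ _ _ (Hu (S n)) H3)|].
    split; [exact (glb_unique _ _ _ (Hv (S n)) H4)|exact H5]. }
  pose (eL n := fst (ee n)); pose (eU n := snd (ee n)).
  assert (Hadv : forall n m, exists J : Z, (0 <= J)%Z /\
    u (n + m)%nat = u n + IZR (Z.of_nat m * N) * b + (b - a) * IZR J).
  { intros n m; induction m as [|m [J [HJ E]]].
    - exists 0%Z; rewrite Nat.add_0_r; simpl; split; [lia|ring].
    - destruct (Hee (n + m)%nat) as [_ [_ [HeL [_ [Es _]]]]].
      exists (J + eL (n + m)%nat)%Z; split; [unfold eL; lia|].
      rewrite Nat.add_succ_r, Es, E.
      replace (Z.of_nat (S m) * N)%Z with (Z.of_nat m * N + N)%Z by lia.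
      rewrite !plus_IZR; unfold eL; ring. }
  (* [i = 0] separates the cuts; [i = 1, -1] excludes touching closed gaps, and
     needs [N >= 2]. *)
  assert (Hirr : forall n m k i, n <> m -> (-1 <= i <= 1)%Z ->
    u n <> u m + (b - a) * IZR i + a * IZR k).
  { assert (Hlt : forall n m k i, (n < m)%nat -> (-1 <= i <= 1)%Z ->
      u m <> u n + (b - a) * IZR i + a * IZR k).
    { intros n m k i Hnm Hi E.
      destruct (Hadv n (m - n)%nat) as [J [HJ EJ]].
      replace (n + (m - n))%nat with m in EJ by lia; rewrite EJ in E.
      (* Collecting the multiples of [a] and of [b] forces the coefficient of [b] to vanish,
         although it is at least [N - 1]. *)
      assert (E0 : (Z.of_nat (m - n) * N + J - i = 0)%Z).
      { apply (ab_irrational (k + J - i)).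
        rewrite !minus_IZR, !plus_IZR; lra. }
      nia. }
    intros n m k i Hnm Hi E; destruct (Nat.lt_total n m) as [H|[H|H]].
    - apply (Hlt n m (- k)%Z (- i)%Z H); [lia|]; rewrite !opp_IZR; lra.
    - contradiction.
    - exact (Hlt m n k i H Hi E). }
  assert (Hneq : forall n m k, n <> m -> u n <> u m + a * IZR k).
  { intros n m k Hnm E; apply (Hirr n m k 0%Z Hnm); [lia|lra]. }
  assert (Hdisj : forall n m k, n <> m ->
    v n <= u m + a * IZR k \/ v m + a * IZR k <= u n).
  { intros n m k Hnm.
    destruct (cuts_compare _ _ _ _ (u n) (v n) (u m) (v m) k
      (Lo_Up_cut n) (Hu n) (Hv n) (Lo_Up_cut m) (Hu m) (Hv m)) as [H|[H|H]]; [tauto|tauto|].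
    exfalso; exact (Hneq n m k Hnm H). }
  assert (Huniq : forall o n m, cut_at a o (Lo n) (Up n) -> cut_at a o (Lo m) (Up m) -> n = m).
  { intros o n m Hn Hm; destruct (Nat.eq_dec n m) as [|Hnm]; [assumption|exfalso].
    destruct (cut_at_lub_eq o _ _ _ _ (u n) (u m) (Lo_Up_cut n) (Hu n)
      (Lo_Up_cut m) (Hu m) Hn Hm) as [k E].
    exact (Hneq n m k Hnm E). }
  (* The gaps are disjoint modulo [a], so they cannot all stay longer than a fixed [d] from some
     index on. *)
  assert (Hfin : forall n0 d, 0 < d -> (forall n, (n0 <= n)%nat -> u n + d <= v n) -> False).
  { intros n0 d Hd H; apply (arc_packing_finite a d (fun n => u (n0 + n)%nat) a_pos Hd).
    intros i j k Hij.
    pose proof (H (n0 + i)%nat ltac:(lia)); pose proof (H (n0 + j)%nat ltac:(lia)).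
    destruct (Hdisj (n0 + i)%nat (n0 + j)%nat k ltac:(lia)); lra. }
  assert (Q0 : Q 0%nat).
  { exists 0%Z; simpl; split; intros x [_ Hx]; lra. }
  assert (HQ : forall n, n <> 0%nat -> ~ Q n).
  { intros n Hn HQn; apply Hn, (Huniq 0); assumption. }
  (* [Y] avoids the hole, so the gap of a cut at [e0 + aZ] contains an entire hole and has length at
     least [b - a]. *)
  assert (HP : forall n, P n -> exists k : Z,
    u n <= e0 + a - b + a * IZR k /\ e0 + a * IZR k <= v n).
  { intros n [k [HL HU]]; exists k; split.
    - apply (Hu n); intros x Hx; specialize (HL x Hx).
      destruct (Rle_lt_dec x (e0 + a - b + a * IZR k)); [assumption|exfalso].
      apply (Y_hole x); [apply (cut_L _ _ _ (Lo_Up_cut n)); assumption|].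
      apply (hole_intro x k); lra.
    - apply (Hv n); exact HU. }
  assert (Hlen0 : forall n, ~ Q n -> ~ P n -> v (S n) - u (S n) = v n - u n).
  { intros n HQn HPn.
    destruct (Hee n) as [jz [jh [_ [_ [Eu [Ev [Ej [[[Jz _]|[_ ?]] [[[Jh _]|[_ ?]] _]]]]]]]]];
      try contradiction.
    replace (snd (ee n)) with (fst (ee n)) in Ev by lia; lra. }
  (* If the hole were never reached, the length [b - a] gained at the first step would persist
     forever. *)
  assert (HexP : exists M, P M).
  { apply NNPP; intros HnP.
    assert (HnP' : forall n, ~ P n) by (intros n Hn; apply HnP; exists n; exact Hn).
    apply (Hfin 1%nat (b - a)); [lra|].
    intros n Hn; induction n as [|n IH]; [lia|].
    destruct (Nat.eq_dec n 0) as [->|Hn0].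
    - destruct (Hee 0%nat) as [jz [jh [HL [HU [Eu [Ev [Ej [[[_ ?]|[Jz _]] [[[Jh _]|[_ ?]] _]]]]]]]]];
        try contradiction; [|exfalso; eapply HnP'; eassumption].
      (* Both exponents lie in [{0, 1}] and differ by one, so their values are forced. *)
      replace (fst (ee 0%nat)) with 0%Z in Eu by lia.
      replace (snd (ee 0%nat)) with 1%Z in Ev by lia.
      specialize (Huv' 0%nat); lra.
    - specialize (IH ltac:(lia)).
      pose proof (Hlen0 n (HQ n Hn0) (HnP' n)); lra. }
  destruct HexP as [M PM].
  assert (HnP : forall n, n <> M -> ~ P n).
  { intros n Hn HPn; apply Hn, (Huniq e0); assumption. }
  (* If the cut at the origin were also the cut through the hole, the two jumps would cancel, and
     the length at least [b - a] given by [HP] would never change. *)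
  destruct M as [|D].
  { exfalso; destruct (HP 0%nat PM) as [k Hk].
    apply (Hfin 0%nat (b - a)); [lra|].
    intros n _; induction n as [|n IH]; [lra|].
    destruct (Nat.eq_dec n 0) as [->|Hn0].
    - destruct (Hee 0%nat) as [jz [jh [HL [HU [Eu [Ev [Ej [[[_ ?]|[Jz _]] [[[_ ?]|[Jh _]] _]]]]]]]]];
        try contradiction.
      replace (snd (ee 0%nat)) with (fst (ee 0%nat)) in Ev by lia; lra.
    - pose proof (Hlen0 n (HQ n Hn0) (HnP n Hn0)); lra. }
  destruct (Hee 0%nat) as [jz [jh [HL [HU [Eu [Ev [Ej [[[_ ?]|[Jz _]] [[[Jh _]|[_ HP0]] _]]]]]]]]];
    try contradiction; [|exfalso; exact (HnP 0%nat ltac:(lia) HP0)].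
  replace (fst (ee 0%nat)) with 0%Z in Eu by lia.
  replace (snd (ee 0%nat)) with 1%Z in Ev by lia.
  clear jz jh HL HU Ej Jz Jh.
  assert (Hlen1 : forall n, (1 <= n <= S D)%nat -> v n - u n = v 0%nat - u 0%nat + (b - a)).
  { intros n Hn; induction n as [|n IH]; [lia|].
    destruct (Nat.eq_dec n 0) as [->|Hn0]; [lra|].
    specialize (IH ltac:(lia)).
    rewrite (Hlen0 n (HQ n Hn0) (HnP n ltac:(lia))); exact IH. }
  assert (Hlen2 : forall n, (S (S D) <= n)%nat -> v n - u n = v 0%nat - u 0%nat).
  { intros n Hn; induction n as [|n IH]; [lia|].
    destruct (Nat.eq_dec n (S D)) as [->|Hn0].
    - specialize (Hlen1 (S D) ltac:(lia)).
      destruct (Hee (S D)) as [jz [jh [HL [HU [Eu' [Ev' [Ej [[[Jz _]|[_ HQD]] [[[_ ?]|[Jh _]] _]]]]]]]]];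
        try contradiction; [|exfalso; exact (HQ (S D) ltac:(lia) HQD)].
      replace (fst (ee (S D))) with 1%Z in Eu' by lia.
      replace (snd (ee (S D))) with 0%Z in Ev' by lia; lra.
    - specialize (IH ltac:(lia)).
      rewrite (Hlen0 n (HQ n ltac:(lia)) (HnP n Hn0)); exact IH. }
  (* After the hole is passed, the initial length of the gap returns for all later cuts, so it must
     be zero. *)
  assert (Euv0 : u 0%nat = v 0%nat).
  { destruct (Rle_lt_or_eq_dec _ _ (Huv' 0%nat)) as [H|H]; [exfalso|exact H].
    apply (Hfin (S (S D)) (v 0%nat - u 0%nat)); [lra|].
    intros n Hn; rewrite <- (Hlen2 n Hn); lra. }
  assert (E0 : u 0%nat = 0).
  { apply Rle_antisym; [|rewrite Euv0].
    - apply (Hu 0%nat); intros x [_ Hx]; lra.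
    - apply (Hv 0%nat); intros x [_ Hx]; exact Hx. }
  assert (Hlen : forall j, (j <= D)%nat -> v (S j) = u (S j) + (b - a)).
  { intros j Hj; specialize (Hlen1 (S j) ltac:(lia)); lra. }
  exists D, (fun j => u (S j)), (fun j => eL (S j)).
  split.
  { enough (Z.of_nat (S D) <= flr (a / (b - a)))%Z by lia.
    apply (arc_packing a (b - a) (S D) (fun j => u (S j))); [lra|].
    intros i j k Hi Hj Hij.
    rewrite <- (Hlen i) by lia.
    destruct (Hdisj (S i) (S j) k ltac:(lia)) as [H|H]; [left; exact H|right].
    rewrite (Hlen j) in H by lia; lra. }
  split; [rewrite Eu, E0; ring|].
  split.
  { intros j Hj; unfold eL.
    destruct (Hee (S j)) as [jz [jh [HL [HU [Eu' [Ev' [Ej [[[Jz _]|[_ HQD]] [[[Jh _]|[_ HPj]] HS]]]]]]]]].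
    - split; [rewrite Eu'; ring|]; split; [lia|].
      intros s Hs; apply HS; trivial; rewrite (Hlen j) by lia; lra.
    - exfalso; exact (HnP (S j) ltac:(lia) HPj).
    - exfalso; exact (HQ (S j) ltac:(lia) HQD).
    - exfalso; exact (HQ (S j) ltac:(lia) HQD). }
  split.
  { destruct (HP (S D) PM) as [k Hk]; exists k.
    specialize (Hlen D ltac:(lia)); lra. }
  intros i j k Hi Hj Hij.
  pose proof (Hirr (S i) (S j) k 1%Z ltac:(lia) ltac:(lia)) as I1.
  pose proof (Hirr (S i) (S j) k (-1)%Z ltac:(lia) ltac:(lia)) as I2.
  pose proof (Hlen i Hi) as Li; pose proof (Hlen j Hj) as Lj.
  destruct (Hdisj (S i) (S j) k ltac:(lia)) as [H|H]; [left | right].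
  - destruct (Rle_lt_or_eq_dec _ _ H) as [H'|H']; [lra|exfalso; apply I2; lra].
  - destruct (Rle_lt_or_eq_dec _ _ H) as [H'|H']; [lra|exfalso; apply I1; lra].
Qed.

End Gaps.

(** * Row sums and windows *)

Lemma sum_f_R0_single (f : nat -> R) (i M : nat) :
  (forall n, n <> i -> f n = 0) -> sum_f_R0 f M = if le_dec i M then f i else 0.
Proof.
  intros Hf; induction M as [|M IH]; cbn [sum_f_R0].
  - destruct (le_dec i 0) as [H|H]; [replace i with 0%nat by lia; reflexivity|].
    apply Hf; lia.
  - rewrite IH; destruct (le_dec i M), (le_dec i (S M)); try lia.
    + rewrite (Hf (S M)) by lia; ring.
    + replace i with (S M) by lia; ring.
    + rewrite (Hf (S M)) by lia; ring.
Qed.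

Lemma sum_f_R0_ge_single (f : nat -> R) (i M : nat) :
  (forall n, 0 <= f n) -> (i <= M)%nat -> f i <= sum_f_R0 f M.
Proof.
  intros Hf Hi; induction M as [|M IH]; cbn [sum_f_R0].
  - replace i with 0%nat by lia; lra.
  - pose proof (Hf (S M)); destruct (Nat.eq_dec i (S M)) as [->|Hne].
    + pose proof (cond_pos_sum f M Hf); lra.
    + specialize (IH ltac:(lia)); lra.
Qed.

Lemma sum_f_R0_ge_pair (f : nat -> R) (i j M : nat) :
  (forall n, 0 <= f n) -> (i < j <= M)%nat -> f i + f j <= sum_f_R0 f M.
Proof.
  intros Hf Hij; induction M as [|M IH]; cbn [sum_f_R0]; [lia|].
  destruct (Nat.eq_dec j (S M)) as [->|Hne].
  - pose proof (sum_f_R0_ge_single f i M Hf ltac:(lia)); lra.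
  - specialize (IH ltac:(lia)); pose proof (Hf (S M)); lra.
Qed.

(** Without an entry [1] every partial sum is [0]; with two of them all large partial sums are at
    least [2]. Tolerance [1] in the definition of the limit excludes both cases. *)
Lemma binary_series_one (w : Z -> R) :
  (forall k, w k = 0 \/ w k = 1) ->
  (Un_cv (fun M => sum_f_R0 (fun n => w (Z.of_nat n - Z.of_nat M)%Z) (2 * M)) 1 <->
   exists k, w k = 1 /\ forall k', w k' = 1 -> k' = k).
Proof.
  intros Hw.
  assert (Hpos : forall k, 0 <= w k) by (intros k; destruct (Hw k); lra).
  split.
  - intros Hcv.
    assert (exists k, w k = 1) as [k Hk].
    { apply NNPP; intros Hno; destruct (Hcv 1 ltac:(lra)) as [M HM].
      specialize (HM M (le_n M)); rewrite (sum_f_R0_single _ 0) in HM.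
      - assert (Z0 : w (Z.of_nat 0 - Z.of_nat M)%Z = 0).
        { destruct (Hw (Z.of_nat 0 - Z.of_nat M)%Z); [assumption|].
          exfalso; apply Hno; eexists; eassumption. }
        rewrite Z0 in HM; unfold Rdist in HM.
        destruct (le_dec 0 (2 * M)); unfold Rabs in HM; destruct (Rcase_abs _); lra.
      - intros n _; destruct (Hw (Z.of_nat n - Z.of_nat M)%Z); [assumption|].
        exfalso; apply Hno; eexists; eassumption. }
    exists k; split; [assumption|]; intros k' Hk'.
    destruct (Z.eq_dec k' k) as [|Hne]; [assumption|exfalso].
    destruct (Hcv 1 ltac:(lra)) as [M0 HM].
    (* This range is large enough to contain both indices. *)
    pose (M := (M0 + Z.abs_nat k + Z.abs_nat k')%nat).
    specialize (HM M ltac:(unfold M; lia)).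
    assert (2 <= sum_f_R0 (fun n => w (Z.of_nat n - Z.of_nat M)%Z) (2 * M)) as H2.
    { assert (E : forall j, (Z.abs_nat j <= M)%nat ->
        w (Z.of_nat (Z.to_nat (j + Z.of_nat M)) - Z.of_nat M)%Z = w j).
      { intros j Hj; f_equal; lia. }
      pose proof (E k ltac:(unfold M; lia)) as E1.
      pose proof (E k' ltac:(unfold M; lia)) as E2.
      destruct (Z_lt_le_dec k k').
      - pose proof (sum_f_R0_ge_pair (fun n => w (Z.of_nat n - Z.of_nat M)%Z)
          (Z.to_nat (k + Z.of_nat M)) (Z.to_nat (k' + Z.of_nat M)) (2 * M)
          (fun n => Hpos _) ltac:(unfold M in *; lia)); simpl in *; lra.
      - pose proof (sum_f_R0_ge_pair (fun n => w (Z.of_nat n - Z.of_nat M)%Z)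
          (Z.to_nat (k' + Z.of_nat M)) (Z.to_nat (k + Z.of_nat M)) (2 * M)
          (fun n => Hpos _) ltac:(unfold M in *; lia)); simpl in *; lra. }
    unfold Rdist in HM; rewrite Rabs_right in HM; lra.
  - intros [k [Hk Huniq]] eps Heps; exists (Z.abs_nat k); intros M HM.
    rewrite (sum_f_R0_single _ (Z.to_nat (k + Z.of_nat M))).
    + destruct (le_dec _ _) as [_|H]; [|lia].
      replace (Z.of_nat (Z.to_nat (k + Z.of_nat M)) - Z.of_nat M)%Z with k by lia.
      rewrite Hk, Rdist_eq; exact Heps.
    + intros n Hn; destruct (Hw (Z.of_nat n - Z.of_nat M)%Z) as [H|H]; [exact H|].
      apply Huniq in H; lia.
Qed.

Definition window (a b c t : R) (m k : Z) : Prop :=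
  a * IZR m <= t + IZR k * b < a * IZR m + c.

(** [X] is the support of the binary vector. Each row is a series of zeros and ones, namely the
    support seen through one window, so [binary_series_one] applies to it. *)
Lemma S_abc_windows (a b c t : R) :
  S_abc a b c t <->
  exists X : Z -> Prop, X 0%Z /\ forall m, exists k, (X k /\ window a b c t m k) /\
    forall k', X k' /\ window a b c t m k' -> k' = k.
Proof.
  assert (Hrow : forall (x : Z -> R) m, (forall k, x k = 0 \/ x k = 1) ->
    (Un_cv (row_sum a b c t x m) 1 <->
     exists k, (x k = 1 /\ window a b c t m k) /\
       forall k', x k' = 1 /\ window a b c t m k' -> k' = k)).
  { intros x m Hx.
    pose (w k := chi c (t - IZR m * a + IZR k * b) * x k).
    assert (Hw1 : forall k, w k = 1 <-> x k = 1 /\ window a b c t m k).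
    { intros k; unfold w, chi, window.
      destruct (excluded_middle_informative _) as [H|H]; split; intros H'.
      - split; lra.
      - lra.
      - lra.
      - exfalso; apply H; lra. }
    assert (Hw : forall k, w k = 0 \/ w k = 1).
    { intros k; unfold w, chi; destruct (excluded_middle_informative _);
        destruct (Hx k) as [E|E]; rewrite E; lra. }
    pose proof (binary_series_one w Hw) as Hser.
    unfold row_sum; fold w; cbv zeta.
    etransitivity; [exact Hser|].
    split; intros [k [H1 H2]]; exists k; (split; [apply Hw1, H1|]);
      intros k' H'; apply H2, Hw1, H'. }
  split.
  - intros [x [[Hx Hx0] Hcv]]; exists (fun k => x k = 1); split; [exact Hx0|].
    intros m; apply (proj1 (Hrow x m Hx)), Hcv.
  - intros [X [HX0 HX]].
    pose (x k := if excluded_middle_informative (X k) then 1 else 0).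
    assert (Hx : forall k, x k = 0 \/ x k = 1).
    { intros k; unfold x; destruct (excluded_middle_informative _); auto. }
    assert (Hx1 : forall k, x k = 1 <-> X k).
    { intros k; unfold x; destruct (excluded_middle_informative _); split; intros;
        (assumption || contradiction || lra). }
    exists x; split; [split; [exact Hx|apply Hx1, HX0]|].
    intros m; apply (Hrow x m Hx).
    destruct (HX m) as [k [[H1 H1'] H2]]; exists k; split; [split; [apply Hx1, H1|exact H1']|].
    intros k' [H3 H3']; apply H2; split; [apply Hx1, H3|exact H3'].
Qed.

(** [[o, o + a)] is a fundamental domain of [aZ], so the representative [y] alone decides
    membership. The base point is [0] for the cases of [R_abc] and [c - a] for those of [Rt_abc]. *)
Lemma plusaZ_Ico (a o u v t y : R) (k : Z) :
  0 < a -> o <= u -> v <= o + a -> o <= y < o + a -> t = y + a * IZR k ->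
  (plusaZ a (Ico u v) t <-> u <= y < v).
Proof.
  intros Ha Hu Hv Hy ->; split.
  - intros [x [j [Hx E]]]; unfold Ico in Hx.
    assert (j = k) as ->.
    { rewrite <- (fl_unique a (x - o + a * IZR j) j), <- (fl_unique a (y - o + a * IZR k) k)
        by lra; f_equal; lra. }
    lra.
  - intros H; exists y, k; split; [exact H|reflexivity].
Qed.

(** * The maps [R_abc] and [Rt_abc] *)

Section Maps.

Context (a b c : R).
Hypothesis a_pos : 0 < a.
Hypothesis a_lt_b : a < b.
Hypothesis c0_gt : b - a < c0 b c.
Hypothesis c0_lt : c0 b c < a.
Hypothesis N_ge2 : (2 <= flr (c / b))%Z.

Notation N := (flr (c / b)).
Notation Rm := (R_abc a b c).
Notation Rtm := (Rt_abc a b c).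
Notation holeR := (hole a b (c0 b c)).
Notation iot := (iota a (c0 b c)).

(** The second hole: [Rt_abc] fixes it, and [R_abc] misses it when started off the first hole. *)
Definition hole_t : R -> Prop := plusaZ a (Ico (c - c0 b c) (c - c0 b c + b - a)).

Lemma c_decomposition : c = IZR N * b + c0 b c.
Proof. unfold c0; ring. Qed.

Lemma Nb_ge : 2 * b <= IZR N * b.
Proof. apply IZR_le in N_ge2; nra. Qed.

Lemma hole_shift (t : R) (k : Z) : holeR (t + a * IZR k) -> holeR t.
Proof.
  intros [x [j [Hx E]]]; exists x, (j - k)%Z; split; [assumption|].
  rewrite minus_IZR; lra.
Qed.

Lemma R_abc_off_hole (t : R) : ~ holeR t -> Rm t = t + IZR (N + iot t) * b.
Proof.
  intros Hh; rewrite plus_IZR.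
  destruct (iota_cases a b (c0 b c) a_pos a_lt_b c0_gt c0_lt t) as [[-> [k Hk]]|[-> [k Hk]]];
    unfold R_abc; cbv zeta;
    destruct (excluded_middle_informative _) as [H|H];
    rewrite (plusaZ_Ico a 0 _ _ t (t - a * IZR k) k) in H by lra; try lra.
  - exfalso; apply Hh; apply (hole_intro a b (c0 b c) t k); lra.
  - destruct (excluded_middle_informative _); [contradiction|lra].
Qed.

Lemma R_abc_ge (t : R) : ~ holeR t -> t + b <= Rm t.
Proof.
  intros Hh; rewrite R_abc_off_hole, plus_IZR by assumption.
  pose proof Nb_ge.
  destruct (iota_cases a b (c0 b c) a_pos a_lt_b c0_gt c0_lt t) as [[-> _]|[-> _]]; lra.
Qed.

(** The interval is what the window starting just after [t] adds beyond the end of the preceding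
    one. Since [c = N * b + c0], only [k = N] and [k = N + 1] can reach it, from the right and from
    the left of the hole respectively; from the hole neither does. *)
Lemma R_abc_window (t : R) (k : Z) :
  a * IZR (fl a t) + c <= t + IZR k * b < a * IZR (fl a t) + a + c ->
  ~ holeR t /\ Rm t = t + IZR k * b.
Proof.
  intros Hk; pose proof c_decomposition as Hc; pose proof (fl_spec a t a_pos) as Hf.
  assert (H1 : (N <= k)%Z).
  { apply Z.lt_pred_le, lt_IZR; rewrite <- Z.sub_1_r, minus_IZR.
    apply (Rmult_lt_reg_r b); lra. }
  assert (H2 : (k <= N + 1)%Z).
  { apply Z.lt_succ_r, lt_IZR; rewrite succ_IZR, plus_IZR.
    apply (Rmult_lt_reg_r b); lra. }
  assert (Hh : ~ holeR t).
  { unfold hole; rewrite (plusaZ_Ico a 0 _ _ t (t - a * IZR (fl a t)) (fl a t)) by lra.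
    intros Hh; assert (k = N \/ k = N + 1)%Z as [-> | ->] by lia; rewrite ?plus_IZR in Hk; lra. }
  split; [assumption|].
  rewrite R_abc_off_hole by assumption; do 3 f_equal.
  destruct (iota_cases a b (c0 b c) a_pos a_lt_b c0_gt c0_lt t) as [[-> [j Hj]]|[-> [j Hj]]].
  - assert (fl a t = j) as Ej by (apply fl_unique; lra); rewrite Ej in *.
    destruct (Z.eq_dec k N) as [->|]; [lra|lia].
  - assert (fl a t = j) as Ej by (apply fl_unique; lra); rewrite Ej in *.
    destruct (Z.eq_dec k (N + 1)) as [->|]; [rewrite plus_IZR in Hk; lra|lia].
Qed.

Lemma R_abc_in_window (t : R) :
  ~ holeR t -> a * IZR (fl a t) + c <= Rm t < a * IZR (fl a t) + a + c.
Proof.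
  intros Hh; pose proof c_decomposition as Hc; rewrite R_abc_off_hole by assumption.
  destruct (iota_cases a b (c0 b c) a_pos a_lt_b c0_gt c0_lt t) as [[-> [j Hj]]|[-> [j Hj]]];
    (assert (fl a t = j) as -> by (apply fl_unique; lra)); rewrite plus_IZR.
  - destruct (Rlt_le_dec t (a * IZR j + c0 b c + a - b)); [lra|].
    exfalso; apply Hh, (hole_intro a b (c0 b c) t j); lra.
  - lra.
Qed.

Lemma Rt_abc_R_abc (t : R) : ~ holeR t -> Rtm (Rm t) = t /\ ~ hole_t (Rm t).
Proof.
  intros Hh; pose proof c_decomposition as Hc.
  pose proof (R_abc_off_hole t Hh) as HR; pose proof (R_abc_in_window t Hh) as HW.
  (* By [R_abc_in_window] this is the representative of [Rm t] in [[c - a, c)], where the cases of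
     [Rt_abc] are read off. *)
  pose (y := Rm t - a * IZR (fl a t + 1)).
  assert (Hy : c - a <= y < c - a + a) by (unfold y; rewrite plus_IZR; lra).
  assert (HI : forall u v, c - a <= u -> v <= c ->
    (plusaZ a (Ico u v) (Rm t) <-> u <= y < v)).
  { intros u v Hu Hv; apply (plusaZ_Ico a (c - a) _ _ _ y (fl a t + 1)); try lra.
    unfold y; ring. }
  unfold y in HI; rewrite plus_IZR in HI; clear y Hy.
  destruct (iota_cases a b (c0 b c) a_pos a_lt_b c0_gt c0_lt t) as [[E [j Hj]]|[E [j Hj]]];
    (assert (Ej : fl a t = j) by (apply fl_unique; lra));
    rewrite E, plus_IZR in HR; rewrite Ej in *;
    (split; [unfold Rt_abc; cbv zeta | unfold hole_t; rewrite HI by lra; lra]);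
    destruct (excluded_middle_informative _) as [H|H]; rewrite HI in H by lra; try lra;
    destruct (excluded_middle_informative _) as [H'|H']; rewrite HI in H' by lra; lra.
Qed.

(** Off [hole_t], the point [Rtm t] belongs to [t + bZ] and to [[a * (k - 1), a * k)], while [t]
    lies in the part newly added by the next window. [R_abc_window] then identifies [t] as the
    image. *)
Lemma R_abc_Rt_abc (t : R) : ~ hole_t t -> Rm (Rtm t) = t /\ ~ holeR (Rtm t).
Proof.
  intros Hh; pose proof c_decomposition as Hc.
  pose (k := fl a (t - (c - a))); pose (y := t - a * IZR k).
  pose proof (fl_spec a (t - (c - a)) a_pos) as Hy; fold k in Hy.
  assert (HI : forall u v, c - a <= u -> v <= c ->
    (plusaZ a (Ico u v) t <-> u <= y < v)).
  { intros u v Hu Hv; apply (plusaZ_Ico a (c - a) _ _ _ y k); unfold y; try lra. }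
  unfold hole_t in Hh; rewrite HI in Hh by lra.
  assert (exists m, (Rtm t = t + IZR m * b) /\ fl a (Rtm t) = (k - 1)%Z) as [m [Em Ek]].
  { unfold Rt_abc; cbv zeta.
    destruct (excluded_middle_informative _) as [H|H]; rewrite HI in H by lra.
    - exists (- N)%Z; split; [rewrite opp_IZR; ring|].
      apply fl_unique; [assumption|]; rewrite minus_IZR; unfold y in H; lra.
    - destruct (excluded_middle_informative _) as [H'|H']; rewrite HI in H' by lra; [lra|].
      exists (- N - 1)%Z; split; [rewrite minus_IZR, opp_IZR; ring|].
      apply fl_unique; [assumption|]; rewrite minus_IZR; unfold y in *; lra. }
  destruct (R_abc_window (Rtm t) (- m)) as [H1 H2].
  - rewrite Ek, minus_IZR, opp_IZR, Em; lra.
  - split; [rewrite H2, opp_IZR, Em; ring | exact H1].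
Qed.

(** * Stability of [S_abc] under translation, [R_abc] and its inverse *)

Lemma S_abc_shift (t : R) (k : Z) : S_abc a b c t -> S_abc a b c (t + a * IZR k).
Proof.
  rewrite !S_abc_windows; intros [X [HX0 HX]]; exists X; split; [exact HX0|].
  assert (Hwin : forall m j, window a b c (t + a * IZR k) m j <-> window a b c t (m - k) j).
  { intros m j; unfold window; rewrite minus_IZR; lra. }
  intros m; destruct (HX (m - k)%Z) as [j [[H1 H2] H3]].
  exists j; split; [split; [exact H1|apply Hwin, H2]|].
  intros j' [H4 H5]; apply H3; split; [exact H4|apply Hwin, H5].
Qed.

(** Let [m = fl a t]. The selected point of window [m + 1] cannot lie in window [m], since
    uniqueness there would make it [t], which window [m + 1] excludes. It is thus a newly added
    point, hence [Rm t], and the same selection rebased at it solves the system for [Rm t]. *)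
Lemma S_abc_R_abc (t : R) : S_abc a b c t -> ~ holeR t /\ S_abc a b c (Rm t).
Proof.
  rewrite !S_abc_windows; intros [X [HX0 HX]].
  pose proof c_decomposition as Hc; pose proof Nb_ge as HN.
  pose proof (fl_spec a t a_pos) as Hf; set (m := fl a t) in *.
  destruct (HX (m + 1)%Z) as [k [[Xk Wk] Uk]].
  assert (Hk : a * IZR m + c <= t + IZR k * b < a * IZR m + a + c).
  { unfold window in Wk; rewrite plus_IZR in Wk.
    split; [|lra].
    destruct (Rle_lt_dec (a * IZR m + c) (t + IZR k * b)) as [|Hlt]; [assumption|exfalso].
    destruct (HX m) as [k0 [_ U0]].
    assert (k = 0%Z) as ->.
    { rewrite (U0 k), (U0 0%Z); trivial; (split; [assumption|unfold window; lra]). }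
    lra. }
  destruct (R_abc_window t k Hk) as [Hh ER]; split; [exact Hh|].
  exists (fun j => X (j + k)%Z); split; [rewrite Z.add_0_l; exact Xk|].
  assert (Hwin : forall m j, window a b c (Rm t) m j <-> window a b c t m (j + k)).
  { intros m' j; unfold window; rewrite ER, plus_IZR; lra. }
  intros m'; destruct (HX m') as [j [[H1 H2] H3]].
  exists (j - k)%Z; split.
  - rewrite Hwin; replace (j - k + k)%Z with j by ring; split; assumption.
  - intros j' [H4 H5]; rewrite Hwin in H5; specialize (H3 _ (conj H4 H5)); lia.
Qed.

(** The mirror argument: [m] is the first window containing [t], so the selected point of window
    [m - 1] precedes [a * m], and [R_abc_window] sends it to [t]. *)
Lemma S_abc_R_abc_onto (t : R) : S_abc a b c t -> exists s, S_abc a b c s /\ Rm s = t.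
Proof.
  intros HS; rewrite S_abc_windows in HS; destruct HS as [X [HX0 HX]].
  pose proof c_decomposition as Hc; pose proof Nb_ge as HN.
  pose proof (fl_spec a (t - (c - a)) a_pos) as Hf; set (m := fl a (t - (c - a))) in *.
  destruct (HX (m - 1)%Z) as [k [[Xk Wk] Uk]].
  unfold window in Wk; rewrite minus_IZR in Wk.
  assert (Hk : t + IZR k * b < a * IZR m).
  { destruct (Rle_lt_dec (a * IZR m) (t + IZR k * b)) as [Hle|]; [exfalso|assumption].
    destruct (HX m) as [k0 [_ U0]].
    assert (k = 0%Z) as ->.
    { rewrite (U0 k), (U0 0%Z); trivial; (split; [assumption|unfold window; lra]). }
    lra. }
  exists (t + IZR k * b); split.
  - rewrite S_abc_windows; exists (fun j => X (j + k)%Z); split; [rewrite Z.add_0_l; exact Xk|].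
    assert (Hwin : forall m j, window a b c (t + IZR k * b) m j <-> window a b c t m (j + k)).
    { intros m' j; unfold window; rewrite plus_IZR; lra. }
    intros m'; destruct (HX m') as [j [[H1 H2] H3]].
    exists (j - k)%Z; split.
    + rewrite Hwin; replace (j - k + k)%Z with j by ring; split; assumption.
    + intros j' [H4 H5]; rewrite Hwin in H5; specialize (H3 _ (conj H4 H5)); lia.
  - destruct (R_abc_window (t + IZR k * b) (- k)) as [_ E].
    + rewrite (fl_unique a (t + IZR k * b) (m - 1)); [|assumption|];
        rewrite minus_IZR, ?opp_IZR; lra.
    + rewrite E, opp_IZR; ring.
Qed.

Lemma first_crossing (f : nat -> R) (x : R) :
  f 0%nat < x -> (exists n, x <= f n) -> exists i, f i < x <= f (S i).
Proof.
  intros H0 [n Hn]; induction n as [|n IH]; [lra|].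
  destruct (Rlt_le_dec (f n) x) as [H|H]; [exists n; split; assumption|auto].
Qed.

Lemma exists_nat_mul_gt (x y : R) : 0 < y -> exists n, x < INR n * y.
Proof.
  intros Hy; destruct (INR_unbounded (x / y)) as [n Hn]; exists n.
  apply (Rmult_lt_compat_r y) in Hn; [|assumption].
  replace (x / y * y) with x in Hn by (field; lra); exact Hn.
Qed.

(* The two-sided orbit of [t] meets each window exactly once: a point [s] of it
   lies in the windows up to [fl a s], and [R_abc s] in those starting right after. *)
Lemma S_abc_of_invariant (V : R -> Prop) :
  (forall t, V t -> ~ holeR t) -> (forall t, V t -> ~ hole_t t) ->
  (forall t, V t -> V (Rm t)) -> (forall t, V t -> V (Rtm t)) ->
  forall t, V t -> S_abc a b c t.
Proof.
  intros Vh Vh' VR VRt t Vt.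
  pose proof c_decomposition as Hc; pose proof Nb_ge as HN.
  assert (VRi : forall n s, V s -> V (Riter n Rm s)).
  { intros n s Hs; induction n; [exact Hs|apply VR; assumption]. }
  assert (VRti : forall n s, V s -> V (Riter n Rtm s)).
  { intros n s Hs; induction n; [exact Hs|apply VRt; assumption]. }
  assert (Rge : forall n s, V s -> s + INR n * b <= Riter n Rm s).
  { intros n s Hs; induction n as [|n IH]; [simpl; lra|].
    pose proof (R_abc_ge _ (Vh _ (VRi n s Hs))) as H; rewrite S_INR.
    change (Riter (S n) Rm s) with (Rm (Riter n Rm s)); lra. }
  assert (Rtle : forall n s, V s -> Riter n Rtm s <= s - INR n * b).
  { intros n s Hs; induction n as [|n IH]; [simpl; lra|].
    pose proof (VRti n s Hs) as Hn.
    destruct (R_abc_Rt_abc _ (Vh' _ Hn)) as [E Hh].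
    pose proof (R_abc_ge _ Hh) as H; rewrite E in H; rewrite S_INR.
    change (Riter (S n) Rtm s) with (Rtm (Riter n Rtm s)); lra. }
  assert (Riter_add : forall m n s, Riter (m + n) Rm s = Riter m Rm (Riter n Rm s)).
  { intros m n s; induction m as [|m IH]; [reflexivity|].
    simpl in *; rewrite IH; reflexivity. }
  assert (Rback : forall n m, Riter n Rm (Riter (n + m) Rtm t) = Riter m Rtm t).
  { intros n m; induction n as [|n IH]; [reflexivity|].
    replace (S n) with (n + 1)%nat at 1 by lia; rewrite Riter_add.
    simpl; destruct (R_abc_Rt_abc (Riter (n + m) Rtm t) (Vh' _ (VRti _ _ Vt))) as [E _].
    unfold Riter in *; rewrite E; exact IH. }
  (* The forward orbits of the backward iterates of [t], nested by [Rback], form the two-sided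
     orbit. *)
  pose (P q := exists n i, q = Riter i Rm (Riter n Rtm t)).
  assert (PV : forall q, P q -> V q).
  { intros q [n [i ->]]; apply VRi, VRti, Vt. }
  assert (Plat : forall q, P q -> exists k, q = t + IZR k * b).
  { assert (HR : forall i s, V s -> exists k, Riter i Rm s = s + IZR k * b).
    { intros i s Hs; induction i as [|i [k IH]]; [exists 0%Z; unfold Riter; simpl; ring|].
      exists (k + (N + iot (Riter i Rm s)))%Z.
      change (Riter (S i) Rm s) with (Rm (Riter i Rm s)).
      rewrite R_abc_off_hole, (plus_IZR k) by auto; lra. }
    intros q [n [i ->]].
    destruct (HR i (Riter n Rtm t) (VRti n t Vt)) as [k1 E1].
    destruct (HR n (Riter n Rtm t) (VRti n t Vt)) as [k2 E2].
    pose proof (Rback n 0%nat) as E3; rewrite Nat.add_0_r in E3; simpl in E3.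
    exists (k1 - k2)%Z; rewrite E1, minus_IZR; rewrite E3 in E2.
    change (Riter 0 Rtm t) with t in E2; lra. }
  (* Both points are forward iterates of one common ancestor, [n + n'] steps behind [t], hence
     comparable. *)
  assert (Plin : forall q q', P q -> P q' ->
    (exists n, q' = Riter n Rm q) \/ (exists n, q = Riter n Rm q')).
  { intros q q' [n [i E]] [n' [i' E']].
    pose (M := (n + n')%nat).
    assert (F : q = Riter (i + n') Rm (Riter M Rtm t)).
    { rewrite Riter_add; unfold M; rewrite (Nat.add_comm n n'), Rback; exact E. }
    assert (F' : q' = Riter (i' + n) Rm (Riter M Rtm t)).
    { rewrite Riter_add; unfold M; rewrite Rback; exact E'. }
    destruct (le_lt_dec (i + n') (i' + n)) as [H|H]; [left | right].
    - exists (i' + n - (i + n'))%nat; rewrite F, <- Riter_add, F'; f_equal; lia.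
    - exists (i + n' - (i' + n))%nat; rewrite F', <- Riter_add, F; f_equal; lia. }
  assert (Puniq : forall q n m, P q -> a * IZR m <= q -> Riter n Rm q < a * IZR m + c ->
    Riter n Rm q = q).
  { intros q n m Pq Hq Hn; destruct n as [|n]; [reflexivity|exfalso].
    replace (S n) with (n + 1)%nat in Hn by lia; rewrite Riter_add in Hn.
    change (Riter 1 Rm q) with (Rm q) in Hn.
    pose proof (Rge n (Rm q) (VR _ (PV _ Pq))) as H1.
    pose proof (R_abc_in_window q (Vh _ (PV _ Pq))) as H2.
    pose proof (fl_ge a q m a_pos Hq) as H3; apply IZR_le in H3.
    apply (Rmult_le_compat_l a) in H3; [|lra].
    pose proof (pos_INR n); assert (0 <= INR n * b) by (apply Rmult_le_pos; lra); lra. }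
  apply S_abc_windows; exists (fun k => P (t + IZR k * b)); split.
  { exists 0%nat, 0%nat; unfold Riter; simpl; ring. }
  intros m.
  (* Start from a backward iterate left of [a * m]. The first forward iterate to cross [a * m] lands
     before [a * m + c], because its predecessor has floor at most [m - 1]. *)
  assert (exists q, P q /\ a * IZR m <= q < a * IZR m + c) as [q [Pq Hq]].
  { destruct (exists_nat_mul_gt (t - a * IZR m) b ltac:(lra)) as [n Hn].
    pose (q0 := Riter n Rtm t).
    assert (Hq0 : q0 < a * IZR m) by (pose proof (Rtle n t Vt); unfold q0; lra).
    destruct (first_crossing (fun i => Riter i Rm q0) (a * IZR m)) as [i [Hi1 Hi2]].
    - exact Hq0.
    - destruct (exists_nat_mul_gt (a * IZR m - q0) b ltac:(lra)) as [i Hi]; exists i.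
      pose proof (Rge i q0 (VRti n t Vt)); lra.
    - exists (Riter (S i) Rm q0); split; [exists n, (S i); reflexivity|].
      split; [exact Hi2|].
      pose proof (R_abc_in_window _ (Vh _ (VRi i _ (VRti n t Vt)))) as HW.
      assert (Hfl : (fl a (Riter i Rm q0) <= m - 1)%Z).
      { apply fl_le; [assumption|]; rewrite minus_IZR; lra. }
      apply IZR_le in Hfl; rewrite minus_IZR in Hfl.
      apply (Rmult_le_compat_l a) in Hfl; [|lra].
      change (Riter (S i) Rm q0) with (Rm (Riter i Rm q0)); fold q0 in HW; lra. }
  destruct (Plat q Pq) as [k Ek]; exists k; rewrite <- Ek; unfold window; rewrite <- Ek.
  split; [split; assumption|].
  intros k' [Pk' Hk'].
  assert (E : t + IZR k' * b = q).
  { destruct (Plin _ _ Pk' Pq) as [[n En]|[n En]].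
    - rewrite En; symmetry; apply (Puniq _ n m); trivial; [lra|rewrite <- En; lra].
    - rewrite En; apply (Puniq _ n m); trivial; [lra|rewrite <- En; lra]. }
  apply eq_IZR, (Rmult_eq_reg_r b); lra.
Qed.

(** * Gaps carried rigidly from the second hole to the first *)

Context (D : nat) (z : nat -> R) (e : nat -> Z).
Hypothesis z_first : z 0%nat = IZR N * b.
Hypothesis z_step : forall j, (j < D)%nat ->
  z (S j) = z j + IZR N * b + (b - a) * IZR (e j).
Hypothesis z_flat : forall j s, (j < D)%nat ->
  z j <= s < z j + (b - a) -> iot s = e j /\ ~ holeR s.
Hypothesis z_last : exists k : Z, z D = c0 b c + a - b + a * IZR k.

Definition in_gap (t : R) : Prop :=
  exists j w k, (j <= D)%nat /\ 0 <= w < b - a /\ t = z j + w + a * IZR k.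

Lemma R_abc_gap (j : nat) (w : R) (k : Z) :
  (j < D)%nat -> 0 <= w < b - a ->
  ~ holeR (z j + w + a * IZR k) /\
  Rm (z j + w + a * IZR k) = z (S j) + w + a * IZR (k + e j).
Proof.
  intros Hj Hw; destruct (z_flat j (z j + w) Hj ltac:(lra)) as [Ei Hh].
  assert (Hh' : ~ holeR (z j + w + a * IZR k)) by (intros H; exact (Hh (hole_shift _ _ H))).
  split; [assumption|].
  rewrite R_abc_off_hole, iota_shift, Ei, z_step, !plus_IZR by assumption; ring.
Qed.

(** The shift [A] is chosen before [w] and [k]: the whole periodic gap moves as one rigid piece. *)
Lemma R_abc_iter_gap (m j : nat) :
  (j + m <= D)%nat -> exists A : Z, forall w k, 0 <= w < b - a ->
    Riter m Rm (z j + w + a * IZR k) = z (j + m)%nat + w + a * IZR (k + A).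
Proof.
  induction m as [|m IH]; intros Hm.
  - exists 0%Z; intros w k _; rewrite Nat.add_0_r, Z.add_0_r; reflexivity.
  - destruct (IH ltac:(lia)) as [A HA]; exists (A + e (j + m)%nat)%Z; intros w k Hw.
    change (Riter (S m) Rm (z j + w + a * IZR k)) with (Rm (Riter m Rm (z j + w + a * IZR k))).
    rewrite HA by assumption.
    destruct (R_abc_gap (j + m) w (k + A) ltac:(lia) Hw) as [_ ->].
    rewrite Nat.add_succ_r, Z.add_assoc; reflexivity.
Qed.

(** Each step of [R_abc_gap] is inverted by [Rt_abc_R_abc], so the chain of gaps is run through
    backwards from the hole. *)
Lemma Rt_abc_iter_gap (n : nat) :
  (n <= D)%nat -> exists B : Z, forall w k, 0 <= w < b - a ->
    Riter n Rtm (z D + w + a * IZR k) = z (D - n)%nat + w + a * IZR (k + B).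
Proof.
  induction n as [|n IH]; intros Hn.
  - exists 0%Z; intros w k _; rewrite Nat.sub_0_r, Z.add_0_r; reflexivity.
  - destruct (IH ltac:(lia)) as [B HB]; exists (B - e (D - S n)%nat)%Z; intros w k Hw.
    change (Riter (S n) Rtm (z D + w + a * IZR k)) with (Rtm (Riter n Rtm (z D + w + a * IZR k))).
    rewrite HB by assumption.
    destruct (R_abc_gap (D - S n) w (k + (B - e (D - S n)%nat)) ltac:(lia) Hw) as [Hh E].
    replace (S (D - S n)) with (D - n)%nat in E by lia.
    replace (k + (B - e (D - S n)%nat) + e (D - S n)%nat)%Z with (k + B)%Z in E by ring.
    rewrite <- E; apply Rt_abc_R_abc; assumption.
Qed.

Lemma hole_in_gap (t : R) :
  holeR t <-> exists w k, 0 <= w < b - a /\ t = z D + w + a * IZR k.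
Proof.
  destruct z_last as [k0 E]; split.
  - intros [x [k [Hx ->]]]; unfold Ico in Hx.
    exists (x - (c0 b c + a - b)), (k - k0)%Z; rewrite minus_IZR; lra.
  - intros [w [k [Hw ->]]]; apply (hole_intro a b (c0 b c) _ (k + k0)).
    rewrite plus_IZR; lra.
Qed.

Lemma hole_t_in_gap (t : R) :
  hole_t t <-> exists w k, 0 <= w < b - a /\ t = z 0%nat + w + a * IZR k.
Proof.
  pose proof c_decomposition as Hc; split.
  - intros [x [k [Hx ->]]]; unfold Ico in Hx.
    exists (x - (c - c0 b c)), k; lra.
  - intros [w [k [Hw ->]]]; exists (z 0%nat + w), k; unfold Ico; lra.
Qed.

(** A gap point reaches the hole after [D - j] steps, which no point of [S_abc] does. Conversely the
    complement of the gaps avoids both holes and is stable under both maps: an image inside a gap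
    would come from the neighbouring gap or lie in a hole that the map misses. [S_abc_of_invariant]
    then applies. *)
Lemma S_abc_iff_not_in_gap (t : R) : S_abc a b c t <-> ~ in_gap t.
Proof.
  split.
  - intros HS [j [w [k [Hj [Hw ->]]]]].
    assert (Hiter : forall n s, S_abc a b c s -> S_abc a b c (Riter n Rm s)).
    { intros n s Hs; induction n; [exact Hs|apply S_abc_R_abc; assumption]. }
    destruct (R_abc_iter_gap (D - j) j ltac:(lia)) as [A HA].
    apply (Hiter (D - j)%nat), S_abc_R_abc in HS; destruct HS as [HS _]; apply HS.
    rewrite HA, hole_in_gap by assumption; exists w, (k + A)%Z; split; [assumption|].
    replace (j + (D - j))%nat with D by lia; reflexivity.
  - revert t; apply S_abc_of_invariant.
    + intros t Ht Hh; apply Ht; rewrite hole_in_gap in Hh.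
      destruct Hh as [w [k Hwk]]; exists D, w, k; split; [lia|exact Hwk].
    + intros t Ht Hh; apply Ht; rewrite hole_t_in_gap in Hh.
      destruct Hh as [w [k Hwk]]; exists 0%nat, w, k; split; [lia|exact Hwk].
    + intros t Ht [j [w [k [Hj [Hw E]]]]].
      assert (Hh : ~ holeR t).
      { rewrite hole_in_gap; intros [w' [k' Hwk]]; apply Ht.
        exists D, w', k'; split; [lia|exact Hwk]. }
      destruct (Rt_abc_R_abc t Hh) as [Et Hh'].
      destruct j as [|j].
      * apply Hh', hole_t_in_gap; exists w, k; split; assumption.
      * apply Ht; destruct (R_abc_gap j w (k - e j) ltac:(lia) Hw) as [Hhj Ej].
        replace (k - e j + e j)%Z with k in Ej by ring; rewrite <- E in Ej.
        apply Rt_abc_R_abc in Hhj; destruct Hhj as [Hj' _].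
        rewrite Ej, Et in Hj'; exists j, w, (k - e j)%Z.
        split; [lia|split; assumption].
    + intros t Ht [j [w [k [Hj [Hw E]]]]].
      assert (Hh : ~ hole_t t).
      { rewrite hole_t_in_gap; intros [w' [k' Hwk]]; apply Ht.
        exists 0%nat, w', k'; split; [lia|exact Hwk]. }
      destruct (R_abc_Rt_abc t Hh) as [Et Hh'].
      destruct (Nat.eq_dec j D) as [->|HjD].
      * apply Hh', hole_in_gap; exists w, k; split; assumption.
      * apply Ht; destruct (R_abc_gap j w k ltac:(lia) Hw) as [_ Ej].
        rewrite <- E, Et in Ej; exists (S j), w, (k + e j)%Z.
        split; [lia|split; assumption].
Qed.

Lemma R_abc_orbit_start (n : nat) :
  (n <= D)%nat -> exists A : Z, Riter n Rm (c - c0 b c) = z n + a * IZR A.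
Proof.
  intros Hn; destruct (R_abc_iter_gap n 0 Hn) as [A HA]; exists A.
  pose proof c_decomposition as Hc.
  replace (c - c0 b c) with (z 0%nat + 0 + a * IZR 0) by lra.
  rewrite HA by lra; simpl; ring.
Qed.

Lemma Rt_abc_orbit_start (n : nat) :
  (n <= D)%nat -> exists B : Z, Riter n Rtm (c0 b c + a - b) = z (D - n)%nat + a * IZR B.
Proof.
  intros Hn; destruct (Rt_abc_iter_gap n Hn) as [B HB], z_last as [k E].
  exists (- k + B)%Z.
  replace (c0 b c + a - b) with (z D + 0 + a * IZR (- k)) by (rewrite opp_IZR; lra).
  rewrite HB by lra; ring.
Qed.

Lemma in_gap_R_abc_points (t : R) :
  (exists n, (n <= D)%nat /\ plusaZ a (fun s => exists u, 0 <= u < b - a /\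
     s = Riter n Rm (c - c0 b c) + u) t) <-> in_gap t.
Proof.
  split.
  - intros [n [Hn [s [k [[u [Hu ->]] ->]]]]].
    destruct (R_abc_orbit_start n Hn) as [A ->].
    exists n, u, (A + k)%Z; rewrite plus_IZR; repeat split; trivial; lra.
  - intros [j [w [k [Hj [Hw ->]]]]]; exists j; split; [assumption|].
    destruct (R_abc_orbit_start j Hj) as [A E].
    exists (z j + a * IZR A + w), (k - A)%Z; split.
    + exists w; rewrite E; split; [assumption|reflexivity].
    + rewrite minus_IZR; ring.
Qed.

Lemma in_gap_R_abc_image (t : R) :
  (exists n, (n <= D)%nat /\ exists s, hole_t s /\ t = Riter n Rm s) <-> in_gap t.
Proof.
  split.
  - intros [n [Hn [s [Hs ->]]]]; apply hole_t_in_gap in Hs; destruct Hs as [w [k [Hw ->]]].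
    destruct (R_abc_iter_gap n 0 Hn) as [A HA]; rewrite HA by assumption.
    exists n, w, (k + A)%Z; repeat split; trivial; lra.
  - intros [j [w [k [Hj [Hw ->]]]]]; exists j; split; [assumption|].
    destruct (R_abc_iter_gap j 0 Hj) as [A HA].
    exists (z 0%nat + w + a * IZR (k - A)); split.
    + apply hole_t_in_gap; exists w, (k - A)%Z; split; [assumption|reflexivity].
    + rewrite HA by assumption; simpl; do 3 f_equal; lia.
Qed.

Lemma in_gap_Rt_abc_image (t : R) :
  (exists n, (n <= D)%nat /\ exists s, holeR s /\ t = Riter n Rtm s) <-> in_gap t.
Proof.
  split.
  - intros [n [Hn [s [Hs ->]]]]; apply hole_in_gap in Hs; destruct Hs as [w [k [Hw ->]]].
    destruct (Rt_abc_iter_gap n Hn) as [B HB]; rewrite HB by assumption.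
    exists (D - n)%nat, w, (k + B)%Z; repeat split; (lia || lra).
  - intros [j [w [k [Hj [Hw ->]]]]]; exists (D - j)%nat; split; [lia|].
    destruct (Rt_abc_iter_gap (D - j) ltac:(lia)) as [B HB].
    exists (z D + w + a * IZR (k - B)); split.
    + apply hole_in_gap; exists w, (k - B)%Z; split; [assumption|reflexivity].
    + rewrite HB by assumption; replace (D - (D - j))%nat with j by lia; do 3 f_equal; lia.
Qed.

Lemma in_gap_Rt_abc_points (t : R) :
  (exists n, (n <= D)%nat /\ plusaZ a (fun s => exists u, 0 <= u < b - a /\
     s = Riter n Rtm (c0 b c + a - b) + u) t) <-> in_gap t.
Proof.
  split.
  - intros [n [Hn [s [k [[u [Hu ->]] ->]]]]].
    destruct (Rt_abc_orbit_start n Hn) as [B ->].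
    exists (D - n)%nat, u, (B + k)%Z; rewrite plus_IZR; repeat split; (lia || lra).
  - intros [j [w [k [Hj [Hw ->]]]]]; exists (D - j)%nat; split; [lia|].
    destruct (Rt_abc_orbit_start (D - j) ltac:(lia)) as [B E].
    replace (D - (D - j))%nat with j in E by lia.
    exists (z j + a * IZR B + w), (k - B)%Z; split.
    + exists w; rewrite E; split; [assumption|reflexivity].
    + rewrite minus_IZR; ring.
Qed.

End Maps.

(** * From the orbit of gaps of the lift to the complement of [S_abc] *)

Theorem theorem5p1 (a b c : R) :
  0 < a -> 0 < b -> 0 < c -> a < b -> b < c ->
  b - a < c0 b c -> c0 b c < a ->
  (2 <= flr (c / b))%Z ->
  (forall p q : Z, q <> 0%Z -> a / b <> IZR p / IZR q) ->
  (exists t, S_abc a b c t) ->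
  exists D : nat,
    (Z.of_nat D <= flr (a / (b - a)) - 1)%Z /\
    (* (1) *)
    (forall n : nat, (n <= D)%nat ->
       forall t, plusaZ a (fun s => s = Riter n (Rt_abc a b c) (c0 b c + a - b)) t <->
                 plusaZ a (fun s => s = Riter (D - n)%nat (R_abc a b c) (c - c0 b c)) t) /\
    (* (2) *)
    (forall n m : nat, (n <= D)%nat -> (m <= D)%nat -> n <> m ->
       forall t,
         ~ (plusaZ a (fun s => exists u, 0 <= u <= b - a /\
                         s = Riter n (R_abc a b c) (c - c0 b c) + u) t /\
            plusaZ a (fun s => exists u, 0 <= u <= b - a /\
                         s = Riter m (R_abc a b c) (c - c0 b c) + u) t)) /\
    (* (3) *)
    (forall t,
       (~ S_abc a b c t <->
        exists n : nat, (n <= D)%nat /\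
          plusaZ a (fun s => exists u, 0 <= u < b - a /\
                      s = Riter n (R_abc a b c) (c - c0 b c) + u) t) /\
       ((exists n : nat, (n <= D)%nat /\
          plusaZ a (fun s => exists u, 0 <= u < b - a /\
                      s = Riter n (R_abc a b c) (c - c0 b c) + u) t) <->
        (exists n : nat, (n <= D)%nat /\
          exists s, plusaZ a (Ico (c - c0 b c) (c - c0 b c + b - a)) s /\
                    t = Riter n (R_abc a b c) s)) /\
       ((exists n : nat, (n <= D)%nat /\
          exists s, plusaZ a (Ico (c - c0 b c) (c - c0 b c + b - a)) s /\
                    t = Riter n (R_abc a b c) s) <->
        (exists n : nat, (n <= D)%nat /\
          exists s, plusaZ a (Ico (c0 b c + a - b) (c0 b c)) s /\
                    t = Riter n (Rt_abc a b c) s)) /\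
       ((exists n : nat, (n <= D)%nat /\
          exists s, plusaZ a (Ico (c0 b c + a - b) (c0 b c)) s /\
                    t = Riter n (Rt_abc a b c) s) <->
        (exists n : nat, (n <= D)%nat /\
          plusaZ a (fun s => exists u, 0 <= u < b - a /\
                      s = Riter n (Rt_abc a b c) (c0 b c + a - b) + u) t))).
Proof.
  intros a_pos b_pos c_pos a_lt_b b_lt_c c0_gt c0_lt N_ge2 irr S_ex.
  assert (ab_irr : forall p q : Z, a * IZR p = b * IZR q -> q = 0%Z).
  { intros p q E; destruct (Z.eq_dec q 0) as [|Hq]; [assumption|exfalso].
    destruct (Z.eq_dec p 0) as [->|Hp].
    - apply Hq, eq_IZR, (Rmult_eq_reg_l b); lra.
    (* With [p] nonzero the equation reads [a / b = q / p], so [p] serves as the denominator. *)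
    - apply (irr q p Hp); pose proof (not_0_IZR p Hp).
      apply (Rmult_eq_reg_r (b * IZR p)).
      + field_simplify; [lra|lra|lra].
      + apply Rmult_integral_contrapositive; split; lra. }
  assert (Hlift : forall x, ~ hole a b (c0 b c) x ->
    R_abc a b c x = lift a b (c0 b c) (flr (c / b)) x + a * IZR (iota a (c0 b c) x)).
  { intros x Hx; rewrite R_abc_off_hole by assumption.
    unfold lift; rewrite plus_IZR; ring. }
  assert (HS := S_abc_R_abc a b c a_pos a_lt_b c0_gt c0_lt N_ge2).
  assert (Hshift := S_abc_shift a b c).
  destruct (gap_orbit a b (c0 b c) (flr (c / b)) (S_abc a b c))
    as [D [z [e [HD [z_first [z_step [z_last z_disj]]]]]]]; trivial.
  { intros x Hx; exact (proj1 (HS x Hx)). }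
  { intros x Hx; destruct (HS x Hx) as [Hh HR].
    apply (Hshift _ (- iota a (c0 b c) x)%Z) in HR.
    rewrite Hlift, opp_IZR in HR by assumption.
    match type of HR with S_abc _ _ _ ?r =>
      replace r with (lift a b (c0 b c) (flr (c / b)) x) in HR by ring end.
    exact HR. }
  { intros y Hy; destruct (S_abc_R_abc_onto a b c a_pos a_lt_b c0_gt c0_lt N_ge2 y Hy)
      as [x [Hx E]].
    pose proof (proj1 (HS x Hx)) as Hh.
    (* Translating the preimage under [R_abc] by [a * iota] makes up for the difference between
       [R_abc] and [lift], as [iota] is [a]-periodic. *)
    exists (x + a * IZR (iota a (c0 b c) x)); split; [apply Hshift, Hx|].
    rewrite <- E, Hlift by assumption; unfold lift; rewrite iota_shift by assumption; ring. }
  assert (z_step' := fun j Hj => proj1 (z_step j Hj)).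
  assert (z_flat := fun j s Hj => proj2 (proj2 (z_step j Hj)) s).
  assert (HR := R_abc_orbit_start a b c a_pos a_lt_b c0_gt c0_lt D z e z_first z_step' z_flat).
  assert (HRt := Rt_abc_orbit_start a b c a_pos a_lt_b c0_gt c0_lt D z e z_step' z_flat z_last).
  exists D; split; [exact HD|]; split; [|split].
  - intros n Hn t; destruct (HRt n Hn) as [B EB], (HR (D - n)%nat ltac:(lia)) as [A EA].
    rewrite EA, EB; split; intros [s [k [-> ->]]].
    + exists (z (D - n)%nat + a * IZR A), (k + B - A)%Z; split; [reflexivity|].
      rewrite minus_IZR, plus_IZR; ring.
    + exists (z (D - n)%nat + a * IZR B), (k + A - B)%Z; split; [reflexivity|].
      rewrite minus_IZR, plus_IZR; ring.
  - intros n m Hn Hm Hnm t [[s [k [[u [Hu ->]] ->]]] [s' [k' [[u' [Hu' ->]] E]]]].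
    destruct (HR n Hn) as [A EA], (HR m Hm) as [A' EA']; rewrite EA, EA' in E.
    (* The integer collects all multiples of [a] relating the two orbit points. A common point of
       the closed gaps contradicts the strict separation. *)
    destruct (z_disj n m (A' + k' - A - k)%Z Hn Hm Hnm) as [H|H];
      rewrite !minus_IZR, plus_IZR in H; lra.
  - intros t.
    assert (G := S_abc_iff_not_in_gap a b c a_pos a_lt_b c0_gt c0_lt N_ge2 D z e
      z_first z_step' z_flat z_last t).
    assert (G1 := in_gap_R_abc_points a b c a_pos a_lt_b c0_gt c0_lt D z e
      z_first z_step' z_flat t).
    assert (G2 := in_gap_R_abc_image a b c a_pos a_lt_b c0_gt c0_lt D z e
      z_first z_step' z_flat t).
    assert (G3 := in_gap_Rt_abc_image a b c a_pos a_lt_b c0_gt c0_lt D z e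
      z_step' z_flat z_last t).
    assert (G4 := in_gap_Rt_abc_points a b c a_pos a_lt_b c0_gt c0_lt D z e
      z_step' z_flat z_last t).
    split; [|split; [|split]].
    + rewrite G1, G; split; [apply NNPP | tauto].
    + exact (iff_trans G1 (iff_sym G2)).
    + exact (iff_trans G2 (iff_sym G3)).
    + exact (iff_trans G3 (iff_sym G4)).
Qed.
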